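(* Let $\rho=\{\rho_k\}_{k=0}^{T-1}\in\mathcal{R}_0$ be a given prior, $\rho_k=\mathcal{N}(0,\Sigma_{\rho_k})$ with $\Sigma_{\rho_k}\succ0$, and set $\bar B_k=B_k^\rho:=B_k(\Sigma_{\rho_k}^{-1}+I)^{-1/2}$ for $k\in\{0,\dots,T-1\}$. Suppose that, for this choice of $\bar B_k$, Assumption (A) (given in the context) holds. In addition, assume that $B_k$ has full column rank for every $k\in\{0,\dots,T-1\}$. Let $\pi^\rho$ be the policy defined in the context. Then the unique optimal solution of $$\min_{\mathbb{P}\in\Pi(\Sigma_{\mathrm{ini}},\Sigma_{\mathrm{fin}})}\ \mathcal{D}_{\mathrm{KL}}[\mathbb{P}\|\mathbb{Q}^\rho]+\mathbb{E}_{\mathbb{P}}[V(x_0,\dots,x_T)]$$ (the generalized Schrödinger bridge problem with fixed reference process distribution $\mathbb{Q}^\rho$) is $\mathbb{P}^{\pi^\rho}$.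
   Context: Notation. $T\ge1$ is an integer, $A_k\in\mathbb{R}^{n\times n}$, $B_k\in\mathbb{R}^{n\times m}$ for $k\in\{0,\dots,T-1\}$; $\Sigma_{\mathrm{ini}},\Sigma_{\mathrm{fin}},\Sigma_{\mathrm{ref}}\succ0$ are $n\times n$; $\mu_{\mathrm{ref}}\in\mathbb{R}^n$. $\mathcal{N}(\mu,\Sigma)$ is the Gaussian distribution, $\mathcal{D}_{\mathrm{KL}}$ the Kullback–Leibler divergence, $B^\dagger$ the Moore–Penrose inverse, $\|x\|_M:=(x^\top Mx)^{1/2}$, $\mathbb{E}_{\mathbb{P}}$ the expectation under $\mathbb{P}$; powers $\pm1/2$ of positive (semi)definite matrices are the symmetric ones. $\chi:=(\mathbb{R}^n)^{T+1}$. The prior class is $\mathcal{R}_0:=\{\rho=\{\rho_k\}_{k=0}^{T-1}\mid\rho_k=\mathcal{N}(0,\Sigma_{\rho_k}),\ \Sigma_{\rho_k}\succ0\}$ with $\rho_k$ distributions on $\mathbb{R}^m$. Reference process. For $\rho\in\mathcal{R}_0$, $\mathbb{Q}^\rho$ is the law on $\chi$ of $\{x_k\}_{k=0}^T$ given by $x_{k+1}=A_kx_k+B_kw_k^\rho$, $w_k^\rho\sim\rho_k$ (independent noise), $x_0\sim\mathcal{N}(\mu_{\mathrm{ref}},\Sigma_{\mathrm{ref}})$. Constraint set and potential. $\Pi(\Sigma_{\mathrm{ini}},\Sigma_{\mathrm{fin}})$ is the set of all probability distributions on $\chi$ whose marginals at $k=0$ and $k=T$ are $\mathcal{N}(0,\Sigma_{\mathrm{ini}})$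 and $\mathcal{N}(0,\Sigma_{\mathrm{fin}})$. Further $$V(x_0,\dots,x_T):=\sum_{k=0}^{T-1}V_k(x_k,x_{k+1}),\qquad V_k(x_k,x_{k+1}):=\tfrac12\|x_{k+1}-A_kx_k\|^2_{B_k^{\dagger\top}B_k^\dagger}.$$ Controlled process. For a policy $\pi=\{\pi_k\}_{k=0}^{T-1}$ ($\pi_k(\cdot|x)$ a conditional density on $\mathbb{R}^m$), $\mathbb{P}^\pi$ is the law on $\chi$ of $x_{k+1}=A_kx_k+B_ku_k$, $u_k\sim\pi_k(\cdot|x_k)$, $x_0\sim\mathcal{N}(0,\Sigma_{\mathrm{ini}})$. Assumption (A), for matrices $A_k$, $\bar B_k$, $\Sigma_{\mathrm{ini}}$, $\Sigma_{\mathrm{fin}}$. Let $\Phi(k,l):=A_{k-1}A_{k-2}\cdots A_l$ for $k>l$, $\Phi(k,k):=I$, $\Phi(k,l):=A_k^{-1}A_{k+1}^{-1}\cdots A_{l-1}^{-1}$ for $k<l$, and for $k_0<k_1$ $$G_r(k_1,k_0):=\sum_{k=k_0}^{k_1-1}\Phi(k_1,k+1)\bar B_k\bar B_k^\top\Phi(k_1,k+1)^\top,$$ $$G_c(k_1,k_0):=\sum_{k=k_0}^{k_1-1}\Phi(k_0,k+1)\bar B_k\bar B_k^\top\Phi(k_0,k+1)^\top.$$ Assumption (A) consists of: (1) $A_k$ is invertible for all $k\in\{0,\dots,T-1\}$; (2) there is $k_r\in\{1,\dots,T\}$ such that $G_r(k,0)$ is invertible for all $k\in\{k_r,\dots,T\}$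 and $G_r(T,k)$ is invertible for all $k\in\{0,\dots,k_r-1\}$; (3) with $S_0:=G_c(T,0)^{-1/2}\Sigma_{\mathrm{ini}}G_c(T,0)^{-1/2}$ and $S_T:=G_c(T,0)^{-1/2}\Phi(0,T)\Sigma_{\mathrm{fin}}\Phi(0,T)^\top G_c(T,0)^{-1/2}$, the two matrices $$\mathcal{F}:=S_0+\tfrac12I-\left(S_0^{1/2}S_TS_0^{1/2}+\tfrac14I\right)^{1/2},\qquad -S_0+\tfrac12I+\left(S_0^{1/2}S_TS_0^{1/2}+\tfrac14I\right)^{1/2}$$ are invertible. The policy $\pi^\rho$. With $\bar B_k=B_k^\rho$, let $Q_{k+1}=A_kQ_kA_k^\top-\bar B_k\bar B_k^\top$, $Q_0=G_c(T,0)^{1/2}S_0^{1/2}\mathcal{F}^{-1}S_0^{1/2}G_c(T,0)^{1/2}$ (under Assumption (A) every $Q_k$ is known to be invertible). Then $\pi_k^\rho(\cdot|x)=\mathcal{N}(-\Sigma_{\pi_k^\rho}B_k^\top Q_{k+1}^{-1}A_kx,\ \Sigma_{\pi_k^\rho})$ with $\Sigma_{\pi_k^\rho}=(\Sigma_{\rho_k}^{-1}+I+B_k^\top Q_{k+1}^{-1}B_k)^{-1}$. This $\pi^\rho$ is the unique minimizer over policies $\pi$ of $\mathbb{E}[\sum_{k=0}^{T-1}\{\frac12\|u_k\|^2+\mathcal{D}_{\mathrm{KL}}[\pi_k(\cdot|x_k)\|\rho_k]\}]$ subject to $x_{k+1}=A_kx_k+B_ku_k$, $u_k\sim\pi_k(\cdot|x_k)$,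 $x_0\sim\mathcal{N}(0,\Sigma_{\mathrm{ini}})$, $x_T\sim\mathcal{N}(0,\Sigma_{\mathrm{fin}})$. *)

(* Defs.v *)
From HB Require Import structures.
From mathcomp Require Import all_boot all_order all_algebra.
From mathcomp Require Import all_classical all_reals all_analysis.
From mathcomp Require Import measurable_realfun.

Set Implicit Arguments.
Unset Strict Implicit.
Unset Printing Implicit Defensive.

Import Order.TTheory GRing.Theory Num.Theory.
Import numFieldNormedType.Exports.

Local Open Scope classical_set_scope.
Local Open Scope ring_scope.

Section matrices.
Context {R : realType}.

Definition psdmx n (S : 'M[R]_n) : Prop :=
  S^T = S /\ forall x : 'cV[R]_n, 0 <= (x^T *m S *m x) ord0 ord0.

Definition pdmx n (S : 'M[R]_n) : Prop :=
  S^T = S /\ forall x : 'cV[R]_n, x != 0 -> 0 < (x^T *m S *m x) ord0 ord0.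

(* The symmetric positive semidefinite square root; 0 if there is none, that
   is, if S is not positive semidefinite. *)
Definition sqrtmx n (S : 'M[R]_n) : 'M[R]_n :=
  xget 0 [set M | psdmx M /\ M *m M = S].

Definition is_mpinv m n (B : 'M[R]_(m, n)) (X : 'M[R]_(n, m)) : Prop :=
  [/\ B *m X *m B = B, X *m B *m X = X,
      (B *m X)^T = B *m X & (X *m B)^T = X *m B].

(* The Moore-Penrose inverse; mathcomp's pinvmx only satisfies the first of
   the four Penrose equations. *)
Definition mpinvmx m n (B : 'M[R]_(m, n)) : 'M[R]_(n, m) :=
  xget 0 [set X | is_mpinv B X].

Definition wnorm n (M : 'M[R]_n) (x : 'cV[R]_n) : R :=
  Num.sqrt ((x^T *m M *m x) ord0 ord0).

End matrices.

Definition measure_cV_display : measure_display.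
Proof. exact: default_measure_display. Qed.

(* R^n is 'cV[R]_n with the sigma-algebra generated by the coordinates, that is,
   its Borel sigma-algebra. *)
Section measurable_cV.
Context {R : realType}.
Variable n : nat.

Let coors : 'I_n -> 'cV[R]_n -> R := fun i x => x i ord0.

Let cV_set0 : g_sigma_preimage coors set0.
Proof. exact: sigma_algebra0. Qed.

Let cV_setC A : g_sigma_preimage coors A -> g_sigma_preimage coors (~` A).
Proof. exact: sigma_algebraC. Qed.

Let cV_bigcup (F : (set 'cV[R]_n)^nat) :
  (forall i, g_sigma_preimage coors (F i)) ->
  g_sigma_preimage coors (\bigcup_i (F i)).
Proof. exact: sigma_algebra_bigcup. Qed.

HB.instance Definition _ := @isMeasurable.Build measure_cV_display
  'cV[R]_n (g_sigma_preimage coors) cV_set0 cV_setC cV_bigcup.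

End measurable_cV.

Section measurable_cV_theory.
Context {R : realType}.

Lemma measurable_coord n (i : 'I_n) :
  measurable_fun [set: 'cV[R]_n] (fun x : 'cV[R]_n => x i ord0).
Proof.
move=> _ Y mY; rewrite setTI; apply: sub_sigma_algebra => /=.
rewrite -bigcup_seq/=; exists i => /=; first by rewrite mem_index_enum.
by exists Y => //; rewrite setTI.
Qed.

Lemma measurable_fun_cV d (T : measurableType d) n (f : T -> 'cV[R]_n) :
  (forall i, measurable_fun [set: T] (fun t => f t i ord0)) ->
  measurable_fun [set: T] f.
Proof.
move=> mf.
have H : g_sigma_preimage (fun i (t : T) => f t i ord0) `<=` measurable.
  apply: smallest_sub; first exact: sigma_algebra_measurable.
  case: n => [|n] in f mf *; first by rewrite big_ord0.
  rewrite -bigcup_mkord_ord; apply: bigcup_sub => i Ii.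
  by move=> A [B mB <-]; exact: mf.
move=> _ A mA; apply: H.
have := @g_sigma_preimage_comp _ R n 'cV[R]_n (fun i x => x i ord0) T f.
by move=> /= ->; exists A.
Qed.

Lemma measurable_fun_mulmx d (T : measurableType d) m n (M : 'M[R]_(m, n))
    (f : T -> 'cV[R]_n) :
  measurable_fun [set: T] f -> measurable_fun [set: T] (fun t => M *m f t).
Proof.
move=> mf; apply: measurable_fun_cV => i.
under eq_fun do rewrite mxE.
apply: measurable_sum => j; apply: measurable_funM => //.
exact: (measurableT_comp (measurable_coord j) mf).
Qed.

Lemma measurable_fun_addmx d (T : measurableType d) n (f g : T -> 'cV[R]_n) :
  measurable_fun [set: T] f -> measurable_fun [set: T] g ->
  measurable_fun [set: T] (fun t => f t + g t).
Proof.
move=> mf mg; apply: measurable_fun_cV => i.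
under eq_fun do rewrite mxE.
apply: measurable_funD; [exact: (measurableT_comp (measurable_coord i) mf)|
  exact: (measurableT_comp (measurable_coord i) mg)].
Qed.

Lemma measurable_rcons d d' (T : measurableType d) (U : measurableType d') n
    (f : T -> n.-tuple U) (g : T -> U) :
  measurable_fun [set: T] f -> measurable_fun [set: T] g ->
  measurable_fun [set: T] (fun t => rcons_tuple (f t) (g t)).
Proof.
move=> mf mg; apply/measurable_fun_tnthP => i.
have [ilt|ige] := ltnP i n.
  rewrite (_ : _ \o _ = @tnth _ U ^~ (Ordinal ilt) \o f).
    exact: (measurableT_comp (measurable_tnth (Ordinal ilt)) mf).
  apply/funext => t /=.
  by rewrite !(tnth_nth (g t)) /= nth_rcons size_tuple ilt.
rewrite (_ : _ \o _ = g)//; apply/funext => t /=.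
rewrite (tnth_nth (g t)) /= nth_rcons size_tuple ltnNge ige /=.
by rewrite if_same.
Qed.

End measurable_cV_theory.


Section kernel_precomposition.
Context d1 d2 d3 (S : measurableType d1) (X : measurableType d2)
  (U : measurableType d3) (R : realType).
Variables (h : {mfun S >-> X}) (k : R.-pker X ~> U).

Definition kpre (s : S) : {measure set U -> \bar R} := k (h s).

Let kpre_measurable A : measurable A ->
  measurable_fun [set: S] (kpre ^~ A).
Proof. by move=> mA; exact: (measurableT_comp (measurable_kernel k A mA)). Qed.

HB.instance Definition _ := isKernel.Build _ _ _ _ _ kpre kpre_measurable.

Let kpreT s : kpre s [set: U] = 1%E.
Proof. exact: prob_kernel. Qed.

HB.instance Definition _ := Kernel_isProbability.Build _ _ _ _ _ kpre kpreT.

End kernel_precomposition.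

(* The law of f (s, u) when s has law P and u has conditional law k (h s)
   given s. *)
Section cond_law.
Local Open Scope ereal_scope.
Context d1 d2 d3 d4 (S : measurableType d1) (X : measurableType d2)
  (U : measurableType d3) (Z : measurableType d4) (R : realType).
Variables (P : probability S R) (h : {mfun S >-> X}) (k : R.-pker X ~> U)
  (f : {mfun (S * U)%type >-> Z}).

Definition cond_law (A : set Z) : \bar R :=
  \int[P]_s k (h s) [set u | A (f (s, u))].

Let msec A s : measurable A -> measurable [set u | A (f (s, u))].
Proof.
move=> mA; rewrite -[X in measurable X]setTI.
have mfs : measurable_fun [set: U] (fun u => f (s, u)).
  by apply: measurableT_comp => //; exact: measurable_pair1.
exact: mfs.
Qed.

Let mint A : measurable A ->
  measurable_fun [set: S] (fun s => k (h s) [set u | A (f (s, u))]).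
Proof.
move=> mA.
have mfA : (f @^-1` A) \in (measurable : set (set (S * U))).
  by rewrite inE -[X in measurable X]setTI; exact: measurable_funPT.
rewrite [X in measurable_fun _ X](_ : _ =
    fun s => kpre h k s (xsection (f @^-1` A) s)).
  exact: (measurable_fun_xsection_finite_kernel (kpre h k) mfA).
by apply/funext => s; rewrite xsectionE.
Qed.

Let cond_law0 : cond_law set0 = 0.
Proof. by rewrite /cond_law; apply: integral0_eq => s _; exact: measure0. Qed.

Let cond_law_ge0 A : 0 <= cond_law A.
Proof. by apply: integral_ge0 => s _; exact: measure_ge0. Qed.

Let cond_law_sigma_additive : semi_sigma_additive cond_law.
Proof.
move=> F mF tF mUF; rewrite [X in _ --> X](_ : _ =
    \sum_(0 <= i <oo) cond_law (F i)).
  by apply: is_cvg_ereal_nneg_natsum => n _; exact: cond_law_ge0.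
rewrite /cond_law -integral_nneseries//; last by move=> n; exact: mint.
apply: eq_integral => s _.
rewrite (_ : [set u | _] = \bigcup_n [set u | F n (f (s, u))]); last first.
  by apply/seteqP; split.
apply/esym; rewrite measure_semi_bigcup//.
- by move=> n; exact: msec.
- apply/trivIsetP => i j _ _ ij.
  move/trivIsetP : tF => /(_ i j I I ij) /seteqP[Fij _].
  by apply/seteqP; split=> // u [Fi Fj]; exact: (Fij (f (s, u))).
- by apply: bigcup_measurable => n _; exact: msec.
Qed.

HB.instance Definition _ := isMeasure.Build _ _ _ cond_law
  cond_law0 cond_law_ge0 cond_law_sigma_additive.

Let cond_lawT : cond_law [set: Z] = 1.
Proof.
rewrite /cond_law (eq_integral (cst 1)) ?integral_cst//; first by
  rewrite mul1e; exact: probability_setT.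
by move=> s _ /=; rewrite prob_kernel.
Qed.

HB.instance Definition _ :=
  Measure_isProbability.Build _ _ _ cond_law cond_lawT.

End cond_law.

Section product_law.
Context d1 d2 (T1 : measurableType d1) (T2 : measurableType d2) (R : realType).
Variables (P1 : probability T1 R) (P2 : probability T2 R).

Definition prod_law : set (T1 * T2) -> \bar R := (P1 \x P2)%E.

HB.instance Definition _ := Measure.on prod_law.

Let prod_lawT : prod_law [set: T1 * T2] = 1%E.
Proof.
transitivity (P1 setT * P2 setT)%E.
  by rewrite -setXTT; exact: product_measure1E.
by rewrite !probability_setT mule1.
Qed.

HB.instance Definition _ :=
  Measure_isProbability.Build _ _ _ prod_law prod_lawT.

End product_law.

Section gaussian.
Context {R : realType}.

(* The library has normal_prob on the type synonym measurableTypeR R of R. *)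
Definition rcons_real n (p : n.-tuple R * measurableTypeR R) : n.+1.-tuple R :=
  rcons_tuple p.1 p.2.

Let measurable_rcons_real n : measurable_fun [set: _] (@rcons_real n).
Proof.
apply: measurable_rcons; first exact: measurable_fst.
exact: (@measurable_snd _ _ (n.-tuple R) (measurableTypeR R)).
Qed.

HB.instance Definition _ n :=
  isMeasurableFun.Build _ _ _ _ (@rcons_real n) (@measurable_rcons_real n).

(* n independent standard real normal variables. *)
Fixpoint iid_normal n : probability (n.-tuple R) R :=
  match n with
  | 0 => dirac [tuple]
  | n'.+1 => distribution (prod_law (iid_normal n') (normal_prob 0 1))
               (@rcons_real n')
  end.

Definition col_of_tuple n (t : n.-tuple R) : 'cV[R]_n := \col_i tnth t i.

Let measurable_col_of_tuple n : measurable_fun [set: _] (@col_of_tuple n).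
Proof.
apply: measurable_fun_cV => i.
by under eq_fun do rewrite mxE; exact: measurable_tnth.
Qed.

HB.instance Definition _ n :=
  isMeasurableFun.Build _ _ _ _ (@col_of_tuple n) (@measurable_col_of_tuple n).

Definition std_gaussian n : probability 'cV[R]_n R :=
  distribution (iid_normal n) (@col_of_tuple n).

Definition gaussian_map n (mu : 'cV[R]_n) (S : 'M[R]_n) (z : 'cV[R]_n) :
  'cV[R]_n := mu + sqrtmx S *m z.

Let measurable_gaussian_map n mu S :
  measurable_fun [set: _] (@gaussian_map n mu S).
Proof. by apply: measurable_fun_addmx => //; exact: measurable_fun_mulmx. Qed.

HB.instance Definition _ n mu S := isMeasurableFun.Build _ _ _ _
  (@gaussian_map n mu S) (@measurable_gaussian_map n mu S).

(* N(mu, S), as the law of mu + S^(1/2) Z with Z standard Gaussian. *)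
Definition gaussian n (mu : 'cV[R]_n) (S : 'M[R]_n) : probability 'cV[R]_n R :=
  distribution (std_gaussian n) (gaussian_map mu S).

Definition gaussian_policy n m (K : 'M[R]_(m, n)) (S : 'M[R]_m) (x : 'cV[R]_n) :
  {measure set 'cV[R]_m -> \bar R} := gaussian (K *m x) S.

Section gaussian_policy_kernel.
Variables (n m : nat) (K : 'M[R]_(m, n)) (S : 'M[R]_m).

Let measurable_gaussian_policy U : measurable U ->
  measurable_fun [set: 'cV[R]_n] (gaussian_policy K S ^~ U).
Proof.
move=> mU; pose g (p : 'cV[R]_n * 'cV[R]_m) := gaussian_map (K *m p.1) S p.2.
have mg : measurable_fun [set: _] g.
  by apply: measurable_fun_addmx; apply: measurable_fun_mulmx.
have mA : measurable (g @^-1` U).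
  by rewrite -[X in measurable X]setTI; exact: mg.
rewrite [X in measurable_fun _ X](_ : _ =
    fun x => std_gaussian m (xsection (g @^-1` U) x)).
  exact: measurable_fun_xsection.
by apply/funext => x; rewrite xsectionE.
Qed.

HB.instance Definition _ := isKernel.Build _ _ _ _ _
  (gaussian_policy K S) measurable_gaussian_policy.

Let gaussian_policyT x : gaussian_policy K S x [set: _] = 1%E.
Proof. exact: probability_setT. Qed.

HB.instance Definition _ := Kernel_isProbability.Build _ _ _ _ _
  (gaussian_policy K S) gaussian_policyT.

End gaussian_policy_kernel.

End gaussian.

Section process.
Context {R : realType}.
Variables n m : nat.

Definition state N (k : 'I_N) (x : N.-tuple 'cV[R]_n) : 'cV[R]_n := tnth x k.

HB.instance Definition _ N (k : 'I_N) :=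
  isMeasurableFun.Build _ _ _ _ (@state N k) (@measurable_tnth _ _ N k).

Definition traj1 (x : 'cV[R]_n) : 1.-tuple 'cV[R]_n := [tuple x].

Let measurable_traj1 : measurable_fun [set: _] traj1.
Proof.
apply/measurable_fun_tnthP => i; rewrite (_ : _ \o _ = id)//.
by apply/funext => x /=; rewrite (tnth_nth x) /= (ord1 i).
Qed.

HB.instance Definition _ :=
  isMeasurableFun.Build _ _ _ _ traj1 measurable_traj1.

Definition next_state (A : 'M[R]_n) (B : 'M[R]_(n, m)) N
    (p : N.+1.-tuple 'cV[R]_n * 'cV[R]_m) : N.+2.-tuple 'cV[R]_n :=
  rcons_tuple p.1 (A *m state ord_max p.1 + B *m p.2).

Let measurable_next_state A B N :
  measurable_fun [set: _] (@next_state A B N).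
Proof.
apply: measurable_rcons => //.
apply: measurable_fun_addmx; apply: measurable_fun_mulmx => //.
exact: (measurableT_comp (measurable_tnth _) measurable_fst).
Qed.

HB.instance Definition _ A B N := isMeasurableFun.Build _ _ _ _
  (@next_state A B N) (@measurable_next_state A B N).

(* The law of (x_0, ..., x_N) where x_0 has law mu0, x_(k+1) = A_k x_k + B_k u_k
   and u_k has law pol_k(. | x_k) given the past. A policy is a family of
   probability kernels; for constant kernels the u_k are independent noises. *)
Fixpoint process_law (A : nat -> 'M[R]_n) (B : nat -> 'M[R]_(n, m))
    (mu0 : probability 'cV[R]_n R) (pol : nat -> R.-pker 'cV[R]_n ~> 'cV[R]_m)
    (N : nat) : probability (N.+1.-tuple 'cV[R]_n) R :=
  match N with
  | 0 => distribution mu0 traj1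
  | N'.+1 => cond_law (process_law A B mu0 pol N')
               (@state N'.+1 ord_max) (pol N') (@next_state (A N') (B N') N')
  end.

End process.

(* Families indexed by {0, ..., T-1} are functions on nat whose values at
   k >= T play no role. In this section B stands for the matrices \bar B_k. *)
Section linear_systems.
Context {R : realType}.
Variables n m : nat.
Implicit Types (A : nat -> 'M[R]_n) (B : nat -> 'M[R]_(n, m)).

(* A_(k-1) ... A_l for l <= k and A_k^-1 ... A_(l-1)^-1 for k < l. *)
Definition Phi A (k l : nat) : 'M[R]_n :=
  if (l <= k)%N then \big[mulmx/1%:M]_(i <- rev (index_iota l k)) A i
  else \big[mulmx/1%:M]_(k <= i < l) invmx (A i).

Definition Gr A B (k1 k0 : nat) : 'M[R]_n :=
  \sum_(k0 <= k < k1) Phi A k1 k.+1 *m B k *m (B k)^T *m (Phi A k1 k.+1)^T.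

Definition Gc A B (k1 k0 : nat) : 'M[R]_n :=
  \sum_(k0 <= k < k1) Phi A k0 k.+1 *m B k *m (B k)^T *m (Phi A k0 k.+1)^T.

Definition S0mx A B (T : nat) (Sini : 'M[R]_n) : 'M[R]_n :=
  let W := invmx (sqrtmx (Gc A B T 0)) in W *m Sini *m W.

Definition STmx A B (T : nat) (Sfin : 'M[R]_n) : 'M[R]_n :=
  let W := invmx (sqrtmx (Gc A B T 0)) in
  W *m Phi A 0 T *m Sfin *m (Phi A 0 T)^T *m W.

Definition Rmx A B (T : nat) (Sini Sfin : 'M[R]_n) : 'M[R]_n :=
  let S0h := sqrtmx (S0mx A B T Sini) in
  sqrtmx (S0h *m STmx A B T Sfin *m S0h + (1 / 4)%:M).

Definition Fmx A B (T : nat) (Sini Sfin : 'M[R]_n) : 'M[R]_n :=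
  S0mx A B T Sini + (1 / 2)%:M - Rmx A B T Sini Sfin.

Definition assumptionA A B (T : nat) (Sini Sfin : 'M[R]_n) : Prop :=
  [/\ forall k, (k < T)%N -> A k \in unitmx,
      exists kr : nat,
        [/\ (1 <= kr <= T)%N,
            forall k, (kr <= k <= T)%N -> Gr A B k 0 \in unitmx &
            forall k, (k < kr)%N -> Gr A B T k \in unitmx],
      Fmx A B T Sini Sfin \in unitmx &
      - S0mx A B T Sini + (1 / 2)%:M + Rmx A B T Sini Sfin \in unitmx].

Fixpoint Qmx A B (T : nat) (Sini Sfin : 'M[R]_n) (k : nat) : 'M[R]_n :=
  match k with
  | 0 =>
      let Gh := sqrtmx (Gc A B T 0) in
      let S0h := sqrtmx (S0mx A B T Sini) in
      Gh *m S0h *m invmx (Fmx A B T Sini Sfin) *m S0h *m Gh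
  | k'.+1 =>
      A k' *m Qmx A B T Sini Sfin k' *m (A k')^T - B k' *m (B k')^T
  end.

End linear_systems.

Section optimal_policy.
Context {R : realType}.
Variables (n m T : nat).
Variables (A : nat -> 'M[R]_n) (B : nat -> 'M[R]_(n, m)).
Variables (Sini Sfin : 'M[R]_n) (Srho : nat -> 'M[R]_m).

Definition Brho (k : nat) : 'M[R]_(n, m) :=
  B k *m invmx (sqrtmx (invmx (Srho k) + 1%:M)).

Definition Qrho (k : nat) : 'M[R]_n := Qmx A Brho T Sini Sfin k.

Definition Spi (k : nat) : 'M[R]_m :=
  invmx (invmx (Srho k) + 1%:M + (B k)^T *m invmx (Qrho k.+1) *m B k).

Definition Kpi (k : nat) : 'M[R]_(m, n) :=
  - (Spi k *m (B k)^T *m invmx (Qrho k.+1) *m A k).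

Definition opt_policy (k : nat) : R.-pker 'cV[R]_n ~> 'cV[R]_m :=
  gaussian_policy (Kpi k) (Spi k).

End optimal_policy.

(* The prior rho_k = N(0, Srho_k), as a policy that ignores the state. *)
Definition prior_policy (R : realType) n m (Srho : nat -> 'M[R]_m) (k : nat) :
    R.-pker 'cV[R]_n ~> 'cV[R]_m :=
  kprobability (measurable_cst (gaussian 0 (Srho k) : pprobability _ R)).

Section bridge.
Context {R : realType}.
Local Open Scope charge_scope.
Local Open Scope ereal_scope.

(* The density may be nonpositive only on a P-null set, so the junk values of
   lne do not matter. *)
Definition KL d (X : measurableType d) (P Q : probability X R) : \bar R :=
  if `[< P `<< Q >] then
    \int[P]_x lne (('d (charge_of_finite_measure P) '/d Q) x)
  else +oo.

Definition same_law d (X : measurableType d) (P Q : probability X R) : Prop :=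
  forall U, measurable U -> P U = Q U.

Definition bridge_set n T (Sini Sfin : 'M[R]_n)
    (P : probability (T.+1.-tuple 'cV[R]_n) R) : Prop :=
  same_law (distribution P (@state R n T.+1 ord0)) (gaussian 0 Sini) /\
  same_law (distribution P (@state R n T.+1 ord_max)) (gaussian 0 Sfin).

Definition stage_potential n m (Ak : 'M[R]_n) (Bk : 'M[R]_(n, m))
    (x y : 'cV[R]_n) : R :=
  (1 / 2 * wnorm ((mpinvmx Bk)^T *m mpinvmx Bk) (y - Ak *m x) ^+ 2)%R.

Definition potential n m T (A : nat -> 'M[R]_n) (B : nat -> 'M[R]_(n, m))
    (x : T.+1.-tuple 'cV[R]_n) : R :=
  (\sum_(k < T) stage_potential (A k) (B k)
     (state (widen_ord (leqnSn T) k) x) (state (lift ord0 k) x))%R.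

Definition bridge_cost n m T (A : nat -> 'M[R]_n) (B : nat -> 'M[R]_(n, m))
    (Q P : probability (T.+1.-tuple 'cV[R]_n) R) : \bar R :=
  KL P Q + 'E_P[potential A B].

Definition unique_minimizer d (X : measurableType d)
    (C : probability X R -> Prop) (J : probability X R -> \bar R)
    (P0 : probability X R) : Prop :=
  let minimizer P := C P /\ forall P', C P' -> J P <= J P' in
  minimizer P0 /\ forall P, minimizer P -> same_law P P0.

End bridge.

(* Main.v *)
Require Import Defs.
From HB Require Import structures.
From mathcomp Require Import all_boot all_order all_algebra.
From mathcomp Require Import spectral complex.
From mathcomp Require Import all_classical all_reals all_analysis.
From mathcomp Require Import measurable_realfun.
From mathcomp Require Import ring lra.

(** Write [Popt] for the law of the optimal process and [Q] for the reference law.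
    Completing squares with the Riccati matrices [Q_k], the density of each
    stage of [Popt] with respect to [Q] is, up to a constant,
      [exp (- |u_k|^2 / 2 + x_k^T Q_k^-1 x_k / 2 - x_(k+1)^T Q_(k+1)^-1 x_(k+1) / 2)],
    and [u_k] is recovered from [(x_k, x_(k+1))] because [B_k] is injective. The
    product telescopes to [dPopt/dQ = exp (psi - V)], where [psi] depends on
    [(x_0, x_T)] only. The end marginals being prescribed, [E_P[psi]] is the same
    number for all competitors, so [KL(P || Q) + E_P[V]] equals
    [KL(P || Popt) + E_P[psi]], which is minimal exactly at [P = Popt].

    The matrices [Q_k] are congruent to [Q_0 - N] with [0 <= N <= G], [G] the
    Gramian, and [Q_0^-1 < G^-1]; this makes them invertible and the policy
    covariances positive definite. The covariance [Sigma_k] of [Popt] at time [k]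
    is followed through [Q_k^-1 Sigma_k Q_k^-1 - Q_k^-1], which evolves by
    congruence with [A_k^-1].

    Gaussian densities are taken with respect to the functional
    [f |-> E [f(Z) exp (|Z|^2 / 2)]], [Z] standard Gaussian, a multiple of the
    Lebesgue integral: it is translation invariant, hence (uniqueness of Haar
    measure) multiplied by a constant under invertible linear maps. *)

Set Implicit Arguments.
Unset Strict Implicit.
Unset Printing Implicit Defensive.

Import Order.TTheory GRing.Theory Num.Theory.
Import numFieldNormedType.Exports.

Local Open Scope classical_set_scope.
Local Open Scope ring_scope.

(** * Positive definite matrices *)

(** The matrices [Q_k] are symmetric and invertible but in general indefinite, so their sign gives
    nothing; the usable input is [Q_0^-1 < G^-1]. It comes from the shape of [Q_0]: with
    [S = S_0^(1/2)] and [K] the square root occurring in [F], minus [1/2], one has [F = S^2 - K] and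
    [K^2 + K = S S_T S]. Then [K] is positive definite, [G^-1 - Q_0^-1] is congruent to [K], and the
    same quadratic equation makes the terminal covariance equal to [Sfin]. On the measure side the
    cost cannot be split at once: its terms may be infinite, and the finiteness of the cost of
    [Popt] has itself to be proved. Whenever [P << Q], the negative part of [ln (dP/dQ)] is
    [P]-integrable; with [V >= 0], a finite cost therefore makes both terms integrable.
    Nonnegativity of the entropy and its equality case are taken from the pointwise inequality
    [x - 1 + exp (- x) >= 0]. Normalising constants are never computed: a positive constant
    independent of the mean is enough for the densities, and total mass one identifies the
    marginals. *)

Section dot_product.
Context {R : realType}.

Definition dotc n (x y : 'cV[R]_n) : R := (x^T *m y) ord0 ord0.

Lemma dotcE n (x y : 'cV[R]_n) : dotc x y = \sum_i x i ord0 * y i ord0.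
Proof. by rewrite /dotc mxE; apply: eq_bigr => i _; rewrite mxE. Qed.

Lemma dotcC n (x y : 'cV[R]_n) : dotc x y = dotc y x.
Proof. by rewrite !dotcE; apply: eq_bigr => i _; rewrite mulrC. Qed.

Lemma dotcDr n (x y z : 'cV[R]_n) : dotc x (y + z) = dotc x y + dotc x z.
Proof. by rewrite /dotc mulmxDr mxE. Qed.

Lemma dotcDl n (x y z : 'cV[R]_n) : dotc (y + z) x = dotc y x + dotc z x.
Proof. by rewrite dotcC dotcDr !(dotcC x). Qed.

Lemma dotcNr n (x y : 'cV[R]_n) : dotc x (- y) = - dotc x y.
Proof. by rewrite /dotc mulmxN mxE. Qed.

Lemma dotcNl n (x y : 'cV[R]_n) : dotc (- y) x = - dotc y x.
Proof. by rewrite dotcC dotcNr dotcC. Qed.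

Lemma dotcZr n a (x y : 'cV[R]_n) : dotc x (a *: y) = a * dotc x y.
Proof. by rewrite /dotc -scalemxAr mxE. Qed.

Lemma dotcZl n a (x y : 'cV[R]_n) : dotc (a *: y) x = a * dotc y x.
Proof. by rewrite dotcC dotcZr dotcC. Qed.

Lemma dotc0r n (x : 'cV[R]_n) : dotc x 0 = 0.
Proof. by rewrite /dotc mulmx0 mxE. Qed.

Lemma dotc0l n (x : 'cV[R]_n) : dotc 0 x = 0.
Proof. by rewrite dotcC dotc0r. Qed.

Lemma dotc_mull m n (M : 'M[R]_(m, n)) x y : dotc (M *m x) y = dotc x (M^T *m y).
Proof. by rewrite /dotc trmx_mul mulmxA. Qed.

Lemma dotc_mulr m n (M : 'M[R]_(m, n)) x y : dotc x (M *m y) = dotc (M^T *m x) y.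
Proof. by rewrite dotc_mull trmxK. Qed.

Lemma dotcxx_ge0 n (x : 'cV[R]_n) : 0 <= dotc x x.
Proof. by rewrite dotcE; apply: sumr_ge0 => i _; rewrite -expr2 sqr_ge0. Qed.

Lemma dotcxx_eq0 n (x : 'cV[R]_n) : (dotc x x == 0) = (x == 0).
Proof.
apply/idP/eqP => [|->]; last by rewrite dotc0r.
rewrite dotcE psumr_eq0 => [/allP h|i _]; last by rewrite -expr2 sqr_ge0.
apply/matrixP => i j; rewrite (ord1 j) mxE; apply/eqP.
by have := h i (mem_index_enum i); rewrite /= mulf_eq0 orbb.
Qed.

Lemma dotcxx_gt0 n (x : 'cV[R]_n) : (0 < dotc x x) = (x != 0).
Proof. by rewrite lt0r dotcxx_ge0 andbT dotcxx_eq0. Qed.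

Lemma dotc_AMGM n (x y : 'cV[R]_n) : 2 * dotc x y <= dotc x x + dotc y y.
Proof.
have := dotcxx_ge0 (x - y).
by rewrite !dotcDl !dotcDr !dotcNr !dotcNl (dotcC y x); lra.
Qed.

End dot_product.

Lemma quadratic_bound_eq0 (R : realFieldType) (a c : R) :
  0 <= a -> 0 <= c -> (forall t, 2 * t * a <= c * t ^+ 2) -> a = 0.
Proof.
move=> a0 c0 h; apply/eqP; rewrite eq_le a0 andbT leNgt; apply/negP => {}a0.
(* A substitute for the minimiser [a / c] of the parabola that stays defined at [c = 0]; the bound
   there would read [2 <= c / (c + 1)]. *)
have := h (a / (c + 1)).
have -> : c * (a / (c + 1)) ^+ 2 = (a / (c + 1)) * (a * (c / (c + 1))) by field; lra.
have -> : 2 * (a / (c + 1)) * a = (a / (c + 1)) * (a * 2) by field; lra.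
rewrite ler_pM2l; last by rewrite divr_gt0//; lra.
by rewrite ler_pM2l// ler_pdivlMr; lra.
Qed.

Section posdef.
Context {R : realType}.

Lemma qformE n (S : 'M[R]_n) (x : 'cV[R]_n) :
  (x^T *m S *m x) ord0 ord0 = dotc x (S *m x).
Proof. by rewrite /dotc mulmxA. Qed.

Lemma psdmxP n (S : 'M[R]_n) :
  psdmx S <-> S^T = S /\ forall x, 0 <= dotc x (S *m x).
Proof.
by split=> -[ST h]; split=> // x; have := h x; rewrite qformE.
Qed.

Lemma pdmxP n (S : 'M[R]_n) :
  pdmx S <-> S^T = S /\ forall x, x != 0 -> 0 < dotc x (S *m x).
Proof.
by split=> -[ST h]; split=> // x /h; rewrite qformE.
Qed.

Lemma psdmx_sym n (S : 'M[R]_n) : psdmx S -> S^T = S. Proof. by case. Qed.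

Lemma pdmx_sym n (S : 'M[R]_n) : pdmx S -> S^T = S. Proof. by case. Qed.

Lemma pd_psdmx n (S : 'M[R]_n) : pdmx S -> psdmx S.
Proof.
move=> /pdmxP[ST h]; apply/psdmxP; split=> // x.
by have [->|/h /ltW//] := eqVneq x 0; rewrite dotc0l.
Qed.

Lemma unitmx_ker n (M : 'M[R]_n) :
  (forall v : 'cV_n, M *m v = 0 -> v = 0) -> M \in unitmx.
Proof.
move=> h; rewrite -unitmx_tr -row_free_unit -kermx_eq0.
apply/eqP/row_matrixP => i; rewrite row0.
apply: trmx_inj; rewrite trmx0; apply: h; apply: trmx_inj.
by rewrite trmx_mul trmxK trmx0 -row_mul mulmx_ker row0.
Qed.

Lemma pdmx_unit n (S : 'M[R]_n) : pdmx S -> S \in unitmx.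
Proof.
move=> /pdmxP[_ h]; apply: unitmx_ker => v Sv0; apply/eqP/negPn/negP => /h.
by rewrite Sv0 dotc0r ltxx.
Qed.

Lemma psdmx_AMGM n (S : 'M[R]_n) x y : psdmx S ->
  2 * dotc x (S *m y) <= dotc x (S *m x) + dotc y (S *m y).
Proof.
move=> /psdmxP[ST /(_ (x - y))].
rewrite mulmxBr !dotcDl !dotcDr !dotcNr !dotcNl.
by rewrite (dotcC y (S *m x)) dotc_mull ST; lra.
Qed.

(** An isotropic vector [x] of a semidefinite form lies in its kernel: with [y = S x],
    semidefiniteness at [t y - x] gives [2 t |y|^2 <= t^2 y^T S y] for every [t], hence [y = 0]. *)
Lemma psd_pdmx n (S : 'M[R]_n) : psdmx S -> S \in unitmx -> pdmx S.
Proof.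
move=> Spsd Su; have [ST h] := (psdmxP S).1 Spsd; apply/pdmxP; split=> // x x0.
rewrite lt0r h andbT; apply: contra x0 => /eqP Sx0.
suff : S *m x = 0.
  by move=> /(congr1 (mulmx (invmx S))); rewrite mulKmx// mulmx0 => ->.
apply/eqP; rewrite -dotcxx_eq0; apply/eqP.
set y := S *m x.
apply: (@quadratic_bound_eq0 R _ (dotc y (S *m y))) => //.
  exact: dotcxx_ge0.
move=> t; have := psdmx_AMGM (t *: y) x Spsd.
rewrite -/y Sx0 addr0 -scalemxAr !dotcZl !dotcZr -/y.
by rewrite mulrA expr2 [_ * (t * t)]mulrC mulrA.
Qed.

Lemma pdmx_inv n (S : 'M[R]_n) : pdmx S -> pdmx (invmx S).
Proof.
move=> Spd; have Su := pdmx_unit Spd; have [ST h] := (pdmxP S).1 Spd.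
apply/pdmxP; split; first by rewrite trmx_inv ST.
move=> x x0; have : invmx S *m x != 0.
  by apply: contra_neq x0 => Sx0; rewrite -(mulKVmx Su x) Sx0 mulmx0.
by move=> /h; rewrite mulKVmx// dotcC.
Qed.

Lemma psdmxD n (S U : 'M[R]_n) : psdmx S -> psdmx U -> psdmx (S + U).
Proof.
move=> /psdmxP[ST hS] /psdmxP[UT hU]; apply/psdmxP; split.
  by rewrite linearD /= ST UT.
by move=> x; rewrite mulmxDl dotcDr addr_ge0.
Qed.

Lemma pdmxDr n (S U : 'M[R]_n) : pdmx S -> psdmx U -> pdmx (S + U).
Proof.
move=> /pdmxP[ST hS] /psdmxP[UT hU]; apply/pdmxP; split.
  by rewrite linearD /= ST UT.
by move=> x x0; rewrite mulmxDl dotcDr ltr_wpDr// hS.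
Qed.

Lemma psdmx_congr n m (M : 'M[R]_(m, n)) S : psdmx S -> psdmx (M *m S *m M^T).
Proof.
move=> /psdmxP[ST hS]; apply/psdmxP; split.
  by rewrite !trmx_mul trmxK ST mulmxA.
by move=> x; rewrite -!mulmxA dotc_mulr.
Qed.

Lemma psdmx_gram n m (M : 'M[R]_(m, n)) : psdmx (M *m M^T).
Proof.
apply/psdmxP; split; first by rewrite trmx_mul trmxK.
by move=> x; rewrite -mulmxA dotc_mulr dotcxx_ge0.
Qed.

Lemma pdmx_congr n (M S : 'M[R]_n) :
  M \in unitmx -> pdmx S -> pdmx (M *m S *m M^T).
Proof.
move=> Mu Spd; apply: psd_pdmx; first exact: psdmx_congr (pd_psdmx Spd).
by rewrite !unitmx_mul Mu (pdmx_unit Spd) unitmx_tr.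
Qed.

Lemma pdmx_scalar n (a : R) : 0 < a -> pdmx (a%:M : 'M[R]_n).
Proof.
move=> a0; apply/pdmxP; split; first by rewrite tr_scalar_mx.
by move=> x x0; rewrite mul_scalar_mx dotcZr mulr_gt0// dotcxx_gt0.
Qed.

Lemma pdmx1 n : pdmx (1%:M : 'M[R]_n).
Proof. exact: pdmx_scalar. Qed.

Lemma psdmx0 n : psdmx (0 : 'M[R]_n).
Proof.
by apply/psdmxP; split=> [|x]; rewrite ?trmx0// mul0mx dotc0r.
Qed.

End posdef.

Section square_root.

(** Newton interpolation, one node at a time; a repeated node needs no new term, so eigenvalues may
    be listed with multiplicity. *)
Lemma poly_interpolation (F : fieldType) (f : F -> F) (s : seq F) :
  exists p : {poly F}, forall x, x \in s -> p.[x] = f x.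
Proof.
elim: s => [|a s [p hp]]; first by exists 0.
have [as_|as_] := boolP (a \in s).
  by exists p => x; rewrite inE => /predU1P[->|]; exact: hp.
pose q := \prod_(b <- s) ('X - b%:P).
have qa0 : q.[a] != 0 by rewrite -/(root q a) root_prod_XsubC.
exists (p + ((f a - p.[a]) / q.[a])%:P * q) => x; rewrite inE.
move=> /predU1P[->|xs]; rewrite !hornerE; first by rewrite divfK// addrC subrK.
have /rootP -> : root q x by rewrite root_prod_XsubC.
by rewrite mulr0 addr0 hp.
Qed.

Context {R : realType}.
Local Notation C := R[i].
Local Notation toC := (real_complex R).
Local Open Scope sesquilinear_scope.
Local Open Scope complex_scope.

(* With q a real polynomial interpolating the fourth root at the eigenvalues of S
   (read off the complex diagonalization), q(S) is symmetric, so its square is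
   positive semidefinite, and its fourth power is S. *)
Lemma sqrtmx_exists n (S : 'M[R]_n) : psdmx S ->
  exists M : 'M[R]_n, psdmx M /\ M *m M = S.
Proof.
case: n S => [|n] S Spsd.
  by exists 0; split; [exact: psdmx0|apply/matrixP => -[]].
have [ST Sge0] := (psdmxP S).1 Spsd.
pose SC := map_mx toC S.
have SCreal : SC \is a mxOver Num.real.
  by apply/mxOverP => i j; rewrite mxE; apply/complex_realP; exists (S i j).
have SCsym : SC \is symmetricmx.
  apply/is_hermitianmxP; rewrite expr0 scale1r map_mx_id// map_trmx ST//.
have /orthomx_spectralP := symmetric_normalmx SCsym SCreal.
set P := spectralmx SC; set D := spectral_diag SC => SCE.
have Pu : P \in unitmx by exact: spectral_unit.
have Dreal i : exists2 d : R, 0 <= d & D ord0 i = toC d.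
  have /mxOverP/(_ ord0 i)/complex_realP[d Dd] : D \is a mxOver Num.real.
    exact: hermitian_spectral_diag_real (realsym_hermsym SCsym SCreal).
  exists d => //.
  pose v := col i (invmx P).
  have v0 : v != 0.
    apply/negP => /eqP vi0; have := mulmxV Pu => /matrixP/(_ i i).
    rewrite !mxE eqxx => /eqP; rewrite big1 ?(eq_sym 0) ?oner_eq0// => j _.
    have /matrixP/(_ j ord0) := vi0; rewrite mxE [RHS]mxE => ->; exact: mulr0.
  have SCv : SC *m v = toC d *: v.
    rewrite {1}SCE /v colE -!mulmxA (mulmxA P) mulmxV// mul1mx scalemxAr.
    congr (_ *m _); apply/matrixP => k j; rewrite (ord1 j) mul_diag_mx !mxE.
    by have [->|] := eqVneq k i; rewrite ?mulr0// Dd.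
  (* The eigenvalue [d] and the matrix [S] are real, so the real and imaginary parts of the
     eigenvector [v] satisfy the same eigenvalue equation; one of them is nonzero, and the form of
     [S] at it shows [d >= 0]. *)
  pose a := map_mx (@complex.Re R) v; pose b := map_mx (@complex.Im R) v.
  have ReM (r : R) z : complex.Re (toC r * z) = r * complex.Re z.
    by case: z => x y /=; rewrite mul0r subr0.
  have ImM (r : R) z : complex.Im (toC r * z) = r * complex.Im z.
    by case: z => x y /=; rewrite mul0r addr0.
  have Sa : S *m a = d *: a.
    apply/matrixP => k j; have /matrixP/(_ k j)/(congr1 (@complex.Re R)) := SCv.
    rewrite !mxE ReM => <-; rewrite (raddf_sum (@complex.Re R)) /=; apply: eq_bigr => l _.
    by rewrite !mxE ReM.
  have Sb : S *m b = d *: b.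
    apply/matrixP => k j; have /matrixP/(_ k j)/(congr1 (@complex.Im R)) := SCv.
    rewrite !mxE ImM => <-; rewrite (raddf_sum (@complex.Im R)) /=; apply: eq_bigr => l _.
    by rewrite !mxE ImM.
  have /orP[a0|b0] : (a != 0) || (b != 0).
    apply: contra_neqT v0; rewrite negb_or !negbK => /andP[/eqP a0 /eqP b0].
    apply/matrixP => k j; have /matrixP/(_ k j) := a0; have /matrixP/(_ k j) := b0.
    by rewrite !mxE; case: (invmx P k i) => x y /= -> ->.
    have := Sge0 a; rewrite Sa dotcZr pmulr_lge0 ?dotcxx_gt0//.
  have := Sge0 b; rewrite Sb dotcZr pmulr_lge0 ?dotcxx_gt0//.
pose Dr i := sval (cid2 (Dreal i)).
have [q hq] := poly_interpolation (fun x => Num.sqrt (Num.sqrt x)) [seq Dr i | i : 'I_n.+1].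
pose N := horner_mx S q.
have NT : N^T = N.
  rewrite /N; elim/poly_ind : (q) => [|p c IHp]; first by rewrite rmorph0 trmx0.
  rewrite rmorphD linearD /= horner_mx_C tr_scalar_mx; congr (_ + _).
  rewrite {1}rmorphM /= horner_mx_X -mulmxE trmx_mul IHp ST mulrC rmorphM /=.
  by rewrite horner_mx_X mulmxE.
exists (N *m N); split; first by rewrite -{2}NT; exact: psdmx_gram.
suff : horner_mx S (q ^+ 4 - 'X) = 0.
  rewrite rmorphB rmorphXn /= horner_mx_X => /eqP; rewrite subr_eq0 => /eqP <-.
  by rewrite -/N !mulmxE -!expr2 -exprM.
apply: (map_mx_inj (f := toC)).
rewrite map_horner_mx -/SC SCE map_mx0 [LHS](horner_mx_uconjC _ _ Pu).
rewrite horner_mx_diag (_ : map_mx _ D = 0) ?linear0 ?mulmx0 ?mul0mx//.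
apply/matrixP => i j; rewrite (ord1 i) !mxE.
have := svalP (cid2 (Dreal j)); set d := sval _ => -[d0 ->].
rewrite horner_map /= !hornerE hq; last by apply/mapP; exists j; rewrite ?mem_enum.
rewrite -/d (exprM _ 2 2) !sqr_sqrtr ?sqrtr_ge0//.
by rewrite subrr.
Qed.

Lemma sqrtmxP n (S : 'M[R]_n) : psdmx S ->
  psdmx (sqrtmx S) /\ sqrtmx S *m sqrtmx S = S.
Proof.
move=> /sqrtmx_exists[M hM].
exact: (@xgetPex _ 0 [set M | psdmx M /\ M *m M = S]%classic (ex_intro _ M hM)).
Qed.

Lemma sqrtmx_sqr n (S : 'M[R]_n) : psdmx S -> sqrtmx S *m sqrtmx S = S.
Proof. by move=> /sqrtmxP[]. Qed.

Lemma tr_sqrtmx n (S : 'M[R]_n) : psdmx S -> (sqrtmx S)^T = sqrtmx S.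
Proof. by move=> /sqrtmxP[[]]. Qed.

Lemma sqrtmx_pd n (S : 'M[R]_n) : pdmx S -> pdmx (sqrtmx S).
Proof.
move=> Spd; have [hp hs] := sqrtmxP (pd_psdmx Spd); apply: psd_pdmx => //.
have := pdmx_unit Spd.
by rewrite -{1}hs unitmx_mul andbb.
Qed.

Lemma sqrtmx_unit n (S : 'M[R]_n) : pdmx S -> sqrtmx S \in unitmx.
Proof. by move=> /sqrtmx_pd/pdmx_unit. Qed.
End square_root.

(** * The Riccati recursion *)

(* [lra] fails when the context contains matrix equations. *)
Ltac dotc_lra :=
  repeat match goal with |- context [dotc ?x ?y] => move: (dotc x y) end;
  clear; intros; lra.

Lemma invmx_mul (R : comUnitRingType) n (M N : 'M[R]_n) :
  M \in unitmx -> N \in unitmx -> invmx (M *m N) = invmx N *m invmx M.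
Proof.
move=> Mu Nu; have MNu : M *m N \in unitmx by rewrite unitmx_mul Mu.
apply: (can_inj (mulKmx MNu)); rewrite mulmxV// mulmxA -(mulmxA M) mulmxV//.
by rewrite mulmx1 mulmxV.
Qed.

Section perturbation.
Context {R : realType} {n : nat}.
Implicit Types G Q N : 'M[R]_n.

(** Suppose [Q v = N v = y] with [y] nonzero, and let [u = G^-1 y]. Then [v^T N u = y^T G^-1 y],
    [v^T N v = y^T Q^-1 y] and [u^T N u <= u^T G u = y^T G^-1 y], so the inequality
    [2 v^T N u <= v^T N v + u^T N u] contradicts [Q^-1 < G^-1]. *)
Lemma unitmx_perturb G Q N : pdmx G -> Q \in unitmx ->
  (forall z, z != 0 -> dotc z (invmx Q *m z) < dotc z (invmx G *m z)) ->
  psdmx N -> psdmx (G - N) ->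
  Q - N \in unitmx.
Proof.
move=> Gpd Qu Qinv_lt Npsd GNpsd; apply: unitmx_ker => v /eqP.
rewrite mulmxBl subr_eq0 => /eqP Qv.
set y := Q *m v; have vE : v = invmx Q *m y by rewrite mulKmx.
have [y0|/Qinv_lt] := eqVneq y 0; first by rewrite vE y0 mulmx0.
rewrite -vE => lt_vy; exfalso; move: lt_vy; pose u := invmx G *m y.
have Gu : G *m u = y by rewrite mulKVmx// pdmx_unit.
have := psdmx_AMGM v u Npsd; rewrite -Qv -/y.
have := ((psdmxP _).1 GNpsd).2 u; rewrite mulmxBl dotcDr dotcNr Gu.
rewrite -/u (dotcC u y) (dotcC v y).
have -> : dotc v (N *m u) = dotc y u.
  by rewrite dotc_mulr (psdmx_sym Npsd) -Qv.
dotc_lra.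
Qed.

(** A quantitative form of [unitmx_perturb]. With [y = (Q - N')^-1 b w], [z = Q y] and
    [c = b^T y + w], the claim is [0 < w . c], and [z = N y + b c]. At [u = G^-1 z], the mean
    inequality for [N] and for the pair [b^T u], [c] gives [z^T G^-1 z <= y^T N y + |c|^2], while
    [z^T Q^-1 z = y^T N y + (b^T y) . c]. *)
Lemma perturb_pd m G Q N (b : 'M[R]_(n, m)) (w : 'cV[R]_m) :
  pdmx G -> Q \in unitmx ->
  (forall z, z != 0 -> dotc z (invmx Q *m z) < dotc z (invmx G *m z)) ->
  psdmx N -> psdmx (G - (N + b *m b^T)) -> w != 0 ->
  0 < dotc w w + dotc w (b^T *m (invmx (Q - (N + b *m b^T)) *m (b *m w))).
Proof.
move=> Gpd Qu Qinv_lt Npsd GNpsd w0; set N' := N + b *m b^T in GNpsd *.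
have N'psd : psdmx N' by apply: psdmxD => //; exact: psdmx_gram.
have QNu := unitmx_perturb Gpd Qu Qinv_lt N'psd GNpsd.
set y := invmx _ *m _; set z := Q *m y.
have zE : z = N' *m y + b *m w.
  have : (Q - N') *m y = b *m w by rewrite /y mulKVmx.
  by rewrite mulmxBl => <-; rewrite addrC subrK.
have yE : y = invmx Q *m z by rewrite /z mulKmx.
have [z0|/Qinv_lt] := eqVneq z 0.
  by rewrite yE z0 !mulmx0 dotc0r addr0 dotcxx_gt0.
rewrite -yE; pose u := invmx G *m z.
have Gu : G *m u = z by rewrite mulKVmx// pdmx_unit.
pose c := b^T *m y + w.
have zE' : z = N *m y + b *m c.
  by rewrite zE /N' /c mulmxDl mulmxDr mulmxA addrA.
have h1 := psdmx_AMGM u y Npsd.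
have h2 := dotc_AMGM (b^T *m u) c.
have := ((psdmxP _).1 GNpsd).2 u.
rewrite mulmxBl dotcDr dotcNr Gu /N' mulmxDl dotcDr -mulmxA (dotc_mulr b u).
have e1 : dotc u z = dotc u (N *m y) + dotc (b^T *m u) c.
  by rewrite {1}zE' dotcDr (dotc_mulr b).
have e2 : dotc z y = dotc y (N *m y) + dotc (b^T *m y) c.
  by rewrite (dotcC z) {1}zE' dotcDr (dotc_mulr b).
rewrite (dotcC z u).
have e3 : dotc (b^T *m y) c = dotc (b^T *m y) (b^T *m y) + dotc (b^T *m y) w.
  by rewrite /c dotcDr.
have e4 : dotc c c = dotc (b^T *m y) (b^T *m y) + 2 * dotc (b^T *m y) w + dotc w w.
  rewrite /c dotcDr !dotcDl (dotcC w); dotc_lra.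
rewrite (dotcC w (_ *m _)).
move: h1 h2 e1 e2 e3 e4; dotc_lra.
Qed.

End perturbation.

Section transition.

HB.instance Definition _ (R : realType) n := Monoid.isLaw.Build 'M[R]_n 1%:M
  (@mulmx R n n n) (@mulmxA R n n n n) (@mul1mx R n n) (@mulmx1 R n n).

Context {R : realType} {n m : nat}.
Variables (A : nat -> 'M[R]_n) (B : nat -> 'M[R]_(n, m)).

Lemma Phi00 : Phi A 0 0 = 1%:M.
Proof. by rewrite /Phi /index_iota /= big_nil. Qed.

Lemma Phi0S k : Phi A 0 k.+1 = Phi A 0 k *m invmx (A k).
Proof.
case: k => [|k]; first by rewrite Phi00 mul1mx /Phi /= big_nat1.
by rewrite /Phi /= big_nat_recr.
Qed.

Lemma Phi0_unit T k : (forall k, (k < T)%N -> A k \in unitmx) -> (k <= T)%N ->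
  Phi A 0 k \in unitmx.
Proof.
move=> Au; elim: k => [|k IHk] kT; first by rewrite Phi00 unitmx1.
by rewrite Phi0S unitmx_mul IHk ?(ltnW kT)// unitmx_inv Au.
Qed.

Lemma Phi_recl k T : (k < T)%N -> Phi A T k = Phi A T k.+1 *m A k.
Proof.
move=> kT; rewrite /Phi (ltnW kT) kT /index_iota.
rewrite subnS -[in LHS](prednK (n := T - k)) ?subn_gt0//=.
by rewrite rev_cons big_rcons.
Qed.

Lemma Phi_Phi0 T k : (forall k, (k < T)%N -> A k \in unitmx) -> (k <= T)%N ->
  Phi A 0 T *m Phi A T k = Phi A 0 k.
Proof.
move=> Au; have [j] := ubnP (T - k)%N; elim: j k => // j IHj k kj kleT.
move: (kleT); rewrite leq_eqVlt => /predU1P[->|ltkT].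
  by rewrite {2}/Phi leqnn /index_iota subnn /= big_nil mulmx1.
rewrite (Phi_recl ltkT) mulmxA IHj//; last first.
  by rewrite -ltnS (leq_trans _ kj)// ltnS subnS prednK// subn_gt0.
by rewrite Phi0S mulmxKV// Au.
Qed.

Lemma GcS k : Gc A B k.+1 0 =
  Gc A B k 0 + (Phi A 0 k.+1 *m B k) *m (Phi A 0 k.+1 *m B k)^T.
Proof. by rewrite /Gc big_nat_recr//= trmx_mul !mulmxA. Qed.

Lemma Gc0 : Gc A B 0 0 = 0.
Proof. by rewrite /Gc big_nil. Qed.

Lemma Gc_psd k : psdmx (Gc A B k 0).
Proof.
elim: k => [|k IHk]; first by rewrite Gc0; exact: psdmx0.
by rewrite GcS; apply: psdmxD => //; exact: psdmx_gram.
Qed.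

Lemma Gc_mono k l : (k <= l)%N -> psdmx (Gc A B l 0 - Gc A B k 0).
Proof.
move=> /subnK <-; elim: (l - k)%N => [|j IHj].
  by rewrite add0n subrr; exact: psdmx0.
by rewrite addSn GcS addrAC; apply: psdmxD => //; exact: psdmx_gram.
Qed.

(** [Gc] is the congruence of [Gr] by [Phi A 0 T], so the invertibility assumed of [Gr] passes to
    it. *)
Lemma Gc_pd T : (forall k, (k < T)%N -> A k \in unitmx) ->
  Gr A B T 0 \in unitmx -> pdmx (Gc A B T 0).
Proof.
move=> Au Gu; apply: psd_pdmx; first exact: Gc_psd.
have -> : Gc A B T 0 = Phi A 0 T *m Gr A B T 0 *m (Phi A 0 T)^T.
  rewrite /Gr mulmx_sumr mulmx_suml; apply: eq_big_nat => k /andP[_ kT].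
  by rewrite -(Phi_Phi0 Au kT) trmx_mul !mulmxA.
by rewrite !unitmx_mul Gu unitmx_tr (Phi0_unit Au (leqnn T)).
Qed.

End transition.

Section half_shift.
Context {R : realType} {n : nat}.

(* Conjugating X = H^2 - 1/4 by H^(1/2) shows that H X is positive
   semidefinite, hence so is X (H + 1/2) = (H + 1/2) (H - 1/2) (H + 1/2). *)
Lemma pdmx_sub_half (H X : 'M[R]_n) : psdmx H -> pdmx X ->
  H *m H = X + (1 / 4)%:M -> pdmx (H - (1 / 2)%:M).
Proof.
move=> Hpsd Xpd HH.
have [HT Hge0] := (psdmxP H).1 Hpsd; have [XT Xgt0] := (pdmxP X).1 Xpd.
have XE : X = H *m H - (1 / 4)%:M by rewrite HH addrK.
pose K := H + (1 / 2)%:M.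
have Kpd : pdmx K by rewrite /K addrC; apply: pdmxDr => //; apply: pdmx_scalar; lra.
have KE : (H - (1 / 2)%:M) *m K = X.
  rewrite /K XE mulmxDr !mulmxBl mul_scalar_mx mul_mx_scalar -scalar_mxM.
  by rewrite addrA subrK; congr (_ - _%:M); field.
have HXpsd : psdmx (X *m H).
  have [RP RR] := sqrtmxP Hpsd; have RT := psdmx_sym RP.
  rewrite (_ : X *m H = sqrtmx H *m X *m (sqrtmx H)^T).
    by apply: psdmx_congr; exact: pd_psdmx.
  rewrite RT XE mulmxBr !mulmxBl -{3 4}RR.
  rewrite mul_scalar_mx mul_mx_scalar -scalemxAl RR; congr (_ - _).
  by move: (sqrtmx H) RR => r <-; rewrite !mulmxA.
apply/pdmxP; split; first by rewrite linearB /= HT tr_scalar_mx.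
move=> v v0; pose u := invmx K *m v.
have vE : v = K *m u by rewrite mulKVmx// pdmx_unit.
have u0 : u != 0 by apply: contra_neq v0 => u0; rewrite vE u0 mulmx0.
rewrite vE mulmxA KE dotc_mull (pdmx_sym Kpd).
have -> : K *m (X *m u) = X *m H *m u + (1 / 2) *: (X *m u).
  rewrite /K mulmxDl mul_scalar_mx mulmxA; congr (_ *m _ + _).
  by rewrite XE mulmxBr mulmxBl mulmxA mul_scalar_mx mul_mx_scalar.
rewrite dotcDr dotcZr ltr_wpDl ?mulr_gt0 ?Xgt0//.
by have [_] := (psdmxP _).1 HXpsd; exact.
Qed.

End half_shift.

Section endpoint_algebra.
Context {R : comUnitRingType} {n : nat}.
Implicit Types q G Gh M K S V : 'M[R]_n.

(** For [q = Q_0] and [M = Sini] the left side is the closed form of the covariance at time [T],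
    carried to time 0 by [Phi A 0 T]. The right side expresses it through [1 - G Q_0^-1], which
    [endpoint_factor] shows to be conjugate to [S^-1 K S^-1]. *)
Lemma endpoint_expand q G M : q \in unitmx ->
  let P := invmx q in let X := q - G in
  X + X *m (P *m M *m P - P) *m X =
  (1%:M - G *m P) *m G + (1%:M - G *m P) *m M *m (1%:M - P *m G).
Proof.
move=> qu P X.
have PX : P *m X = 1%:M - P *m G by rewrite /X mulmxBr mulVmx.
have XP : X *m P = 1%:M - G *m P by rewrite /X mulmxBl mulmxV.
have XPG : X *m P *m G = X - X *m P *m X.
  by rewrite {4}/X mulmxBr -(mulmxA X P q) (mulVmx qu) mulmx1 opprB addrC subrK.
rewrite -PX -XP; move: (X) XPG => Y XPG.
by rewrite mulmxBr mulmxBl !mulmxA XPG addrA addrAC.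
Qed.

Lemma endpoint_factor Gh V : Gh \in unitmx ->
  let W := invmx Gh in let P := W *m (1%:M - V) *m W in
  (1%:M - Gh *m Gh *m P = Gh *m V *m W) * (1%:M - P *m (Gh *m Gh) = W *m V *m Gh).
Proof.
move=> Ghu W P; split.
  rewrite /P !mulmxA (mulmxK Ghu) mulmxBr mulmxBl mulmx1 mulmxV//.
  by rewrite opprB addrC subrK.
rewrite /P !mulmxA (mulmxKV Ghu) mulmxBr mulmxBl mulmx1 mulVmx//.
by rewrite opprB addrC subrK.
Qed.

(** The inner factor [Gh S^2 Gh] is [Sini]; its two factors [S] cancel one [S^-1] on either side, so
    that the summands contribute [K] and [K^2] between identical outer factors. *)
Lemma endpoint_collapse Gh S K : Gh \in unitmx -> S \in unitmx ->
  let W := invmx Gh in let V := invmx S *m K *m invmx S in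
  Gh *m V *m W *m (Gh *m Gh) +
    Gh *m V *m W *m (Gh *m (S *m S) *m Gh) *m (W *m V *m Gh) =
  Gh *m (invmx S *m (K + K *m K) *m invmx S) *m Gh.
Proof.
move=> Ghu Su W V; rewrite mulmxDr mulmxDl mulmxDr mulmxDl /V !mulmxA.
rewrite !(mulmxKV Ghu) (mulmxK Ghu) (mulmxKV Su); congr (_ + _).
by rewrite (mulmxK Su).
Qed.

End endpoint_algebra.

Section riccati.
Context {R : realType} {n m : nat}.
Variables (A : nat -> 'M[R]_n) (b : nat -> 'M[R]_(n, m)) (T : nat).
Variables (Sini Sfin : 'M[R]_n).
Hypotheses (Sini_pd : pdmx Sini) (Sfin_pd : pdmx Sfin).
Hypothesis A_unit : forall k, (k < T)%N -> A k \in unitmx.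
Hypothesis Gr_unit : Gr A b T 0 \in unitmx.
Hypothesis F_unit : Fmx A b T Sini Sfin \in unitmx.

Local Notation G := (Gc A b T 0).
Local Notation Gh := (sqrtmx G).
Local Notation W := (invmx Gh).
Local Notation S0 := (S0mx A b T Sini).
Local Notation S := (sqrtmx S0).
Local Notation S_T := (STmx A b T Sfin).
Local Notation H := (Rmx A b T Sini Sfin).
Local Notation F := (Fmx A b T Sini Sfin).
Local Notation Q := (Qmx A b T Sini Sfin).
Local Notation Psi := (Phi A 0).

Let Gpd : pdmx G := Gc_pd A_unit Gr_unit.

Let GhGh : Gh *m Gh = G.
Proof. exact: sqrtmx_sqr (pd_psdmx Gpd). Qed.

Let Gh_unit : Gh \in unitmx := sqrtmx_unit Gpd.

Let GhT : Gh^T = Gh.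
Proof. exact: tr_sqrtmx (pd_psdmx Gpd). Qed.

Let WT : W^T = W.
Proof. by rewrite trmx_inv GhT. Qed.

Let W_unit : W \in unitmx.
Proof. by rewrite unitmx_inv. Qed.

Let S0_pd : pdmx S0.
Proof. by rewrite /S0mx -{2}WT; exact: pdmx_congr. Qed.

Let SS : S *m S = S0.
Proof. exact: sqrtmx_sqr (pd_psdmx S0_pd). Qed.

Let S_unit : S \in unitmx := sqrtmx_unit S0_pd.

Let ST : S^T = S.
Proof. exact: tr_sqrtmx (pd_psdmx S0_pd). Qed.

Let S_T_pd : pdmx S_T.
Proof.
rewrite /STmx (_ : W *m Psi T *m Sfin *m (Psi T)^T *m W =
  (W *m Psi T) *m Sfin *m (W *m Psi T)^T); last by rewrite trmx_mul WT !mulmxA.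
apply: pdmx_congr => //.
by rewrite unitmx_mul W_unit (Phi0_unit A_unit (leqnn T)).
Qed.

Let X_pd : pdmx (S *m S_T *m S).
Proof. by rewrite -{2}ST; exact: pdmx_congr. Qed.

Let X14_psd : psdmx (S *m S_T *m S + (1 / 4)%:M).
Proof.
by apply: psdmxD; [exact: pd_psdmx|apply/pd_psdmx/pdmx_scalar; rewrite divr_gt0].
Qed.

Let HH : H *m H = S *m S_T *m S + (1 / 4)%:M.
Proof. exact: sqrtmx_sqr. Qed.

Let H_psd : psdmx H.
Proof. by have [] := sqrtmxP X14_psd. Qed.

(** The positive root of [K^2 + K = S S_T S]: completing this square is the origin of the [1/4] and
    the [1/2] in [Rmx] and [Fmx]. *)
Let K := H - (1 / 2)%:M.

Let K_pd : pdmx K.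
Proof. exact: pdmx_sub_half X_pd HH. Qed.

Let FE : F = S *m S - K.
Proof. by rewrite SS /Fmx /K opprB addrA. Qed.

Let Q0E : Q 0 = Gh *m S *m invmx F *m S *m Gh.
Proof. by []. Qed.

Let Q0_unit : Q 0 \in unitmx.
Proof. by rewrite Q0E !unitmx_mul Gh_unit S_unit unitmx_inv F_unit. Qed.

Let Q0V : invmx (Q 0) = W *m (invmx S *m F *m invmx S) *m W.
Proof.
apply: (can_inj (mulKmx Q0_unit)); rewrite mulmxV// Q0E !mulmxA.
by rewrite (mulmxK Gh_unit) (mulmxK S_unit) (mulmxKV F_unit) (mulmxK S_unit) mulmxV.
Qed.

Let SFS : invmx S *m F *m invmx S = 1%:M - invmx S *m K *m invmx S.
Proof. by rewrite FE mulmxBr mulmxBl mulKmx// mulmxV. Qed.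

(** The difference [G^-1 - Q_0^-1] equals [W S^-1 K S^-1 W], a congruence of the positive definite
    [K]. *)
Lemma Qmx0_inv_lt z : z != 0 ->
  dotc z (invmx (Q 0) *m z) < dotc z (invmx G *m z).
Proof.
move=> z0; have -> : invmx G = W *m W.
  apply: (can_inj (mulKmx (pdmx_unit Gpd))); rewrite mulmxV ?pdmx_unit//.
  by rewrite -{1}GhGh -mulmxA (mulKVmx Gh_unit) mulmxV.
rewrite Q0V SFS mulmxBr mulmxBl mulmx1 mulmxBl dotcDr dotcNr gtrDl oppr_lt0.
rewrite -{1}WT -!mulmxA dotc_mulr trmxK dotc_mulr trmx_inv ST.
have [_] := (pdmxP _).1 K_pd; apply; apply: contra_neq z0.
move=> /(congr1 (mulmx (Gh *m S))).
by rewrite mulmx0 !mulmxA (mulmxK S_unit) (mulmxV Gh_unit) mul1mx.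
Qed.

Let FT : F^T = F.
Proof. by rewrite FE linearB /= trmx_mul ST (pdmx_sym K_pd). Qed.

Lemma Qmx_sym k : (Q k)^T = Q k.
Proof.
elim: k => [|k IHk].
  by rewrite Q0E !trmx_mul trmx_inv FT ST GhT !mulmxA.
by rewrite /= linearB /= !trmx_mul !trmxK IHk mulmxA.
Qed.

Lemma Qmx_congr k : (k <= T)%N ->
  Psi k *m Q k *m (Psi k)^T = Q 0 - Gc A b k 0.
Proof.
elim: k => [|k IHk] kT; first by rewrite Phi00 mul1mx trmx1 mulmx1 Gc0 subr0.
rewrite GcS opprD addrA -(IHk (ltnW kT)).
rewrite [Q k.+1]/= mulmxBr mulmxBl trmx_mul !mulmxA; congr (_ - _).
rewrite Phi0S (mulmxKV (A_unit kT)) -!mulmxA -trmx_mul (mulmxKV (A_unit kT)).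
by [].
Qed.

Lemma Psi_unit k : (k <= T)%N -> Psi k \in unitmx.
Proof. exact: Phi0_unit. Qed.

Lemma Qmx_unit k : (k <= T)%N -> Q k \in unitmx.
Proof.
move=> kT; have := Psi_unit kT => Pu.
have : Psi k *m Q k *m (Psi k)^T \in unitmx.
  rewrite Qmx_congr//; apply: (unitmx_perturb Gpd Q0_unit Qmx0_inv_lt).
    exact: Gc_psd.
  exact: Gc_mono.
by rewrite !unitmx_mul unitmx_tr Pu andbT.
Qed.

(** Positivity of [1 + b_k^T Q_(k+1)^-1 b_k], the normalised precision of the policy. Carried to
    time 0, [Q_(k+1)] becomes [Q_0] minus the Gramian up to [k] minus the single term of stage [k],
    which is the setting of [perturb_pd]. *)
Lemma Qmx_form_pd k (w : 'cV[R]_m) : (k < T)%N -> w != 0 ->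
  0 < dotc w w + dotc w ((b k)^T *m (invmx (Q k.+1) *m (b k *m w))).
Proof.
move=> kT w0; have Pu := Psi_unit kT.
have -> : invmx (Q k.+1) =
    (Psi k.+1)^T *m invmx (Q 0 - Gc A b k.+1 0) *m Psi k.+1.
  have PTu : (Psi k.+1)^T \in unitmx by rewrite unitmx_tr.
  rewrite -(Qmx_congr kT) (invmx_mul _ PTu) ?unitmx_mul ?Pu ?Qmx_unit//.
  by rewrite invmx_mul ?Qmx_unit// mulKVmx// mulmxKV.
have := @perturb_pd R n m G (Q 0) (Gc A b k 0) (Psi k.+1 *m b k) w Gpd Q0_unit Qmx0_inv_lt.
rewrite -GcS trmx_mul !mulmxA; apply => //; first exact: Gc_psd.
exact: Gc_mono.
Qed.

(** The covariance of the optimal state at time [k], solved in closed form so that its value at [T]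
    can be computed directly. The middle factor at [k = 0] is the one that makes the value there
    equal to [Sini]. *)
Definition Sigmx k : 'M[R]_n := Q k + Q k *m ((Psi k)^T *m
  (invmx (Q 0) *m Sini *m invmx (Q 0) - invmx (Q 0)) *m Psi k) *m Q k.

Lemma Sigmx0 : Sigmx 0 = Sini.
Proof.
rewrite /Sigmx; move: (Q 0) Q0_unit => q qu.
rewrite Phi00 trmx1 mul1mx mulmx1 mulmxBr mulmxBl !mulmxA mulmxV// mul1mx.
by rewrite mulmxKV// mul1mx addrC subrK.
Qed.

(** Carried to time 0, the covariance is [Gh S^-1 (K + K^2) S^-1 Gh]; since [K + K^2 = S S_T S],
    only [Gh S_T Gh] remains, and this is [Sfin] carried to time 0. *)
Lemma SigmxT : Sigmx T = Sfin.
Proof.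
have Pu := Psi_unit (leqnn T).
suff E : Psi T *m Sigmx T *m (Psi T)^T = Psi T *m Sfin *m (Psi T)^T.
  have PTu : (Psi T)^T \in unitmx by rewrite unitmx_tr.
  by apply: (can_inj (mulKmx Pu)); exact: (can_inj (mulmxK PTu)).
have -> : Psi T *m Sigmx T *m (Psi T)^T = (Q 0 - G) +
    (Q 0 - G) *m (invmx (Q 0) *m Sini *m invmx (Q 0) - invmx (Q 0)) *m (Q 0 - G).
  by rewrite /Sigmx mulmxDr mulmxDl -(Qmx_congr (leqnn T)) !mulmxA.
rewrite (endpoint_expand _ _ Q0_unit).
have SiniE : Gh *m (S *m S) *m Gh = Sini.
  by rewrite SS /S0mx !mulmxA (mulmxKV Gh_unit) mulmxV// mul1mx.
have [E1 E2] := endpoint_factor (invmx S *m K *m invmx S) Gh_unit.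
rewrite GhGh -SFS -Q0V in E1 E2; rewrite E1 E2.
have := endpoint_collapse K Gh_unit S_unit; rewrite /= SiniE GhGh => ->.
have -> : K + K *m K = S *m S_T *m S.
  apply: (addIr (1 / 4)%:M); rewrite -HH -[in RHS](subrK (1 / 2)%:M H) -/K.
  move: (K) => L; rewrite mulmxDr !mulmxDl mul_scalar_mx mul_mx_scalar -scalar_mxM.
  have LE : L = (1 / 2) *: L + (1 / 2) *: L by rewrite -scalerDl -splitr scale1r.
  rewrite [X in X + _ *m _]LE [X in X + _ = _]addrC -!addrA; congr (_ + (_ + (_ + _%:M))).
  by field.
rewrite -!mulmxA mulKmx// mulKVmx// /STmx /= !mulmxA.
by rewrite (mulmxK S_unit) (mulmxKV Gh_unit).
Qed.

End riccati.

(** * One stage of the closed loop *)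

Section closed_loop.
Context {R : realType} {n m : nat}.
Variables (A Q Q' : 'M[R]_n) (B : 'M[R]_(n, m)) (Mr : 'M[R]_m).
Hypotheses (A_unit : A \in unitmx) (Q_unit : Q \in unitmx).
Hypotheses (Q'_unit : Q' \in unitmx) (Mr_unit : Mr \in unitmx).
Hypotheses (Q_sym : Q^T = Q) (Q'_sym : Q'^T = Q') (Mr_sym : Mr^T = Mr).
Hypothesis Q'E : Q' = A *m Q *m A^T - B *m invmx Mr *m B^T.

Let U := Mr + B^T *m invmx Q' *m B.
Hypothesis U_unit : U \in unitmx.

Let Z := A *m Q *m A^T.
Let W := B *m invmx Mr *m B^T.
Let K := - (invmx U *m B^T *m invmx Q' *m A).

Let Z_unit : Z \in unitmx.
Proof. by rewrite !unitmx_mul A_unit Q_unit unitmx_tr. Qed.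

Let WE : W = Z - Q'.
Proof. by rewrite Q'E -/Z -/W opprB addrC subrK. Qed.

Let U_sym : U^T = U.
Proof.
by rewrite /U linearD /= !trmx_mul trmxK trmx_inv Q'_sym Mr_sym mulmxA.
Qed.

(** Push-through identity: it trades the precision [U] and [Q'] for [Mr] and [Z], after which [B]
    times the gain involves only [B Mr^-1 B^T = Z - Q']. *)
Let gainE : invmx U *m B^T *m invmx Q' = invmx Mr *m B^T *m invmx Z.
Proof.
suff : U *m (invmx Mr *m B^T *m invmx Z) = B^T *m invmx Q'.
  by move=> E; rewrite -[LHS]mulmxA -E mulKmx.
have -> : U *m (invmx Mr *m B^T *m invmx Z) =
    (B^T + B^T *m invmx Q' *m W) *m invmx Z.
  by rewrite /U mulmxDl mulmxDl /W !mulmxA mulmxV// mul1mx.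
rewrite WE mulmxBr (mulmxKV Q'_unit) addrC subrK.
by rewrite (mulmxK Z_unit).
Qed.

Lemma closed_loopE : A + B *m K = Q' *m invmx Z *m A.
Proof.
rewrite /K gainE mulmxN !mulmxA -/W WE !mulmxBl mulmxV// mul1mx.
by rewrite opprB addrC subrK.
Qed.

Lemma closed_loop_unit : A + B *m K \in unitmx.
Proof. by rewrite closed_loopE !unitmx_mul Q'_unit unitmx_inv Z_unit. Qed.

Let noiseE : B *m invmx U *m B^T = Q' - Q' *m invmx Z *m Q'.
Proof.
have -> : B *m invmx U *m B^T = B *m (invmx U *m B^T *m invmx Q') *m Q'.
  by rewrite -!mulmxA mulVmx// mulmx1.
rewrite gainE !mulmxA -/W WE !mulmxBl mulmxV// mul1mx.
by [].
Qed.

(** The gain satisfies [(A + B K) Q = Q' A^-T], which carries [D] to [A^-T D A^-1]. The term without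
    [D] gives [Q' Z^-1 Q'], exactly what the noise covariance [Q' - Q' Z^-1 Q'] lacks to be [Q']. *)
Lemma closed_loop_cov (D : 'M[R]_n) :
  (A + B *m K) *m (Q + Q *m D *m Q) *m (A + B *m K)^T + B *m invmx U *m B^T =
  Q' + Q' *m ((invmx A)^T *m D *m invmx A) *m Q'.
Proof.
have ZT : Z^T = Z by rewrite /Z !trmx_mul trmxK Q_sym mulmxA.
have FQ : (A + B *m K) *m Q = Q' *m (invmx A)^T.
  have ATu : A^T \in unitmx by rewrite unitmx_tr.
  apply: (can_inj (mulmxK ATu)); rewrite trmx_inv (mulmxKV ATu) closed_loopE.
  by rewrite -!mulmxA (mulmxA A) -/Z (mulVmx Z_unit) mulmx1.
have QF : Q *m (A + B *m K)^T = invmx A *m Q'.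
  by rewrite -[in LHS]Q_sym -trmx_mul FQ trmx_mul trmxK Q'_sym.
rewrite mulmxDr mulmxDl noiseE.
rewrite -[X in X + _ + _]mulmxA QF {1}closed_loopE -!mulmxA (mulKVmx A_unit).
rewrite QF !mulmxA FQ.
by rewrite addrC addrA subrK.
Qed.

(** Completion of the square in [u]: the cross term dictates [K], and the remaining form in [x]
    matches because the Riccati step yields [K^T U K = A^T Q'^-1 A - Q^-1]. *)
Lemma stage_identity (x : 'cV[R]_n) (u : 'cV[R]_m) :
  dotc (u - K *m x) (U *m (u - K *m x)) =
  dotc u (Mr *m u) + dotc (A *m x + B *m u) (invmx Q' *m (A *m x + B *m u))
    - dotc x (invmx Q *m x).
Proof.
have UK : U *m K = - (B^T *m invmx Q' *m A).
  by rewrite /K mulmxN -!mulmxA mulKVmx.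
have KUK : dotc (K *m x) (U *m (K *m x)) =
    dotc (A *m x) (invmx Q' *m (A *m x)) - dotc x (invmx Q *m x).
  rewrite mulmxA UK /K !mulNmx dotcNl dotcNr opprK gainE -!mulmxA.
  set y := A *m x; rewrite -(dotc_mull B).
  rewrite (mulmxA B) (mulmxA (B *m _)) -/W WE mulmxBl (mulKVmx Z_unit) dotcDl dotcNl; congr (_ - _).
  rewrite dotc_mull Q'_sym (mulKVmx Q'_unit) /y dotc_mulr dotcC.
  suff -> : A^T *m (invmx Z *m (A *m x)) = invmx Q *m x by [].
  have ATu : A^T \in unitmx by rewrite unitmx_tr.
  apply: (can_inj (mulKmx Q_unit)); rewrite (mulKVmx Q_unit).
  apply: (can_inj (mulKmx A_unit)).
  by rewrite !(mulmxA A) (mulmxA (A *m Q)) -/Z (mulKVmx Z_unit).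
have cross : dotc u (U *m (K *m x)) = - dotc (B *m u) (invmx Q' *m (A *m x)).
  by rewrite mulmxA UK mulNmx dotcNr dotc_mull !mulmxA.
rewrite mulmxBr !dotcDl !dotcDr !dotcNl !dotcNr !mulmxDr !dotcDr KUK.
rewrite (dotcC (K *m x) (U *m u)) (dotc_mull U) U_sym cross.
have -> : dotc u (U *m u) = dotc u (Mr *m u) + dotc (B *m u) (invmx Q' *m (B *m u)).
  by rewrite /U mulmxDl dotcDr [X in _ = _ + X]dotc_mull !mulmxA.
have -> : dotc (A *m x) (invmx Q' *m (B *m u)) = dotc (B *m u) (invmx Q' *m (A *m x)).
  by rewrite dotc_mulr trmx_inv Q'_sym dotcC.
ring.
Qed.

End closed_loop.

(** * Gaussian measures *)

Section cond_law_integral.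
Local Open Scope ereal_scope.
Context d1 d2 d3 d4 (S : measurableType d1) (X : measurableType d2)
  (U : measurableType d3) (Z : measurableType d4) (R : realType).
Variables (P : probability S R) (h : {mfun S >-> X}) (k : R.-pker X ~> U)
  (f : {mfun (S * U)%type >-> Z}).

(** In a composition of kernels the second one also sees the source of the first. Here the law [P]
    is a kernel from [unit], so the conditioning variable is read off a pair. *)
Definition snd_cond (p : unit * S) : X := h p.2.

Let measurable_snd_cond : measurable_fun [set: unit * S] snd_cond.
Proof. exact: (measurableT_comp (@measurable_funPT _ _ _ _ h) measurable_snd). Qed.

HB.instance Definition _ :=
  isMeasurableFun.Build _ _ _ _ snd_cond measurable_snd_cond.

Let mF : measurable_fun [set: (unit * S) * U] (fun p => f (p.1.2, p.2)).
Proof.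
apply: (measurableT_comp (@measurable_funPT _ _ _ _ f)).
apply: measurable_fun_pair => //.
exact: measurableT_comp measurable_snd measurable_fst.
Qed.

Lemma ge0_integral_cond_law (g : Z -> \bar R) :
  measurable_fun [set: Z] g -> (forall z, 0 <= g z) ->
  \int[cond_law P h k f]_z g z = \int[P]_s \int[k (h s)]_u g (f (s, u)).
Proof.
move=> mg g0.
pose l := kprobability (measurable_cst (P : pprobability S R)) : R.-pker unit ~> S.
pose k' := kpre snd_cond k \; kdirac mF.
transitivity (\int[kcomp l k' tt]_z g z).
  apply: eq_measure_integral => A mA _.
  apply: eq_integral => s _ /=; rewrite /kcomp /= /kdirac /kpre /snd_cond /=.
  have mfA : measurable [set u | A (f (s, u))].
    rewrite -[X in measurable X]setTI.
    have mfs : measurable_fun [set: U] (fun u => f (s, u)).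
      by apply: measurableT_comp => //; exact: measurable_pair1.
    exact: mfs.
  by rewrite -[[set u | _] in LHS]setIT -integral_indic.
rewrite integral_kcomp//; apply: eq_integral => s _.
rewrite integral_kcomp//; apply: eq_integral => u _.
rewrite integral_dirac ?diracT ?mul1e//.
Qed.

End cond_law_integral.

Section standard_normal.
Local Open Scope ereal_scope.
Context {R : realType}.
Local Notation mu := (@lebesgue_measure R).
Local Notation N01 := (@normal_prob R 0%R 1%R).
Implicit Types f : measurableTypeR R -> \bar R.

Lemma ge0_integral_normal_prob f :
  measurable_fun setT f -> (forall x, 0 <= f x) ->
  \int[N01]_x f x = \int[mu]_x (f x * (normal_pdf 0 1 x)%:E).
Proof.
move=> mf f0; have dom := @normal_prob_dominates R 0%R 1%R.
rewrite -(Radon_Nikodym_SigmaFinite.change_of_variables dom)//.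
set g := Radon_Nikodym_SigmaFinite.f _ _.
have gint : mu.-integrable setT g by exact: Radon_Nikodym_SigmaFinite.f_integrable.
have mpdf : measurable_fun setT (fun x => (normal_pdf 0 1 x : R)%:E).
  by apply/measurable_EFinP; exact: measurable_normal_pdf.
apply: ge0_ae_eq_integral => //.
- by apply: emeasurable_funM => //; exact: measurable_int gint.
- exact: emeasurable_funM.
- by move=> x _; rewrite mule_ge0// Radon_Nikodym_SigmaFinite.f_ge0.
- by move=> x _; rewrite mule_ge0// lee_fin normal_pdf_ge0.
- apply: ae_eqe_mul2l; apply: integral_ae_eq => //.
  by move=> E _ mE; rewrite -Radon_Nikodym_SigmaFinite.f_integral.
Qed.

Definition shiftR (a x : R) : measurableTypeR R := (x + a)%R.

Lemma measurable_shiftR a :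
  measurable_fun [set: measurableTypeR R] (shiftR a : measurableTypeR R -> _).
Proof. by apply: (@measurable_funD _ R R). Qed.

HB.instance Definition _ a := isMeasurableFun.Build _ _
  (measurableTypeR R) (measurableTypeR R) (shiftR a) (measurable_shiftR a).

Lemma lebesgue_measure_shift a (A : set (measurableTypeR R)) : measurable A ->
  pushforward mu (shiftR a : measurableTypeR R -> _) A = mu A.
Proof.
move=> mA; apply/esym/lebesgue_measure_unique => //=; first exact: measurable_shiftR.
move=> _ _ [[b c] _ <-].
rewrite /pushforward (_ : _ @^-1` _ = `]b - a, c - a]%classic)%R.
  rewrite !lebesgue_measure_itv/= !lte_fin ltrD2r; case: ifPn => // _.
  by rewrite -!EFinB; congr EFin; ring.
by apply/seteqP; split => x /=; rewrite !in_itv/= /shiftR ltrBlDr lerBrDr.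
Qed.

Lemma ge0_integral_lebesgue_shift a f :
  measurable_fun setT f -> (forall x, 0 <= f x) ->
  \int[mu]_x f (shiftR a x) = \int[mu]_x f x.
Proof.
move=> mf f0.
transitivity (\int[pushforward mu (shiftR a : measurableTypeR R -> _)]_x f x).
  by rewrite ge0_integral_pushforward//; exact: measurable_shiftR.
apply: eq_measure_integral => [|/= ? A mA _]; first exact: measurable_shiftR.
exact: lebesgue_measure_shift.
Qed.

Lemma standard_normal_shift a f :
  measurable_fun setT f -> (forall x, 0 <= f x) ->
  \int[N01]_x (f (shiftR a x) * (expR (x ^+ 2 / 2))%:E) =
  \int[N01]_x (f x * (expR (x ^+ 2 / 2))%:E).
Proof.
move=> mf f0.
have me : measurable_fun setT (fun x : R => (expR (x ^+ 2 / 2))%:E).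
  apply/measurable_EFinP/measurableT_comp => //; exact: measurable_funM.
have mfa : measurable_fun setT (f \o shiftR a : measurableTypeR R -> _).
  exact: measurableT_comp mf (measurable_shiftR a).
rewrite !ge0_integral_normal_prob//; last 4 first.
  exact: emeasurable_funM.
  by move=> x; rewrite mule_ge0// lee_fin expR_ge0.
  exact: emeasurable_funM.
  by move=> x; rewrite mule_ge0// lee_fin expR_ge0.
have E x (y : \bar R) : y * (expR (x ^+ 2 / 2))%:E * (normal_pdf 0 1 x)%:E = y * (normal_peak 1)%:E.
  rewrite normal_pdfE ?oner_neq0// -muleA -EFinM; congr (_ * _%:E); rewrite mulrCA /normal_fun.
  by rewrite -expRD subr0 expr1n mulNr addrN expR0 mulr1.
under eq_integral do rewrite E.
under [RHS]eq_integral do rewrite E.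
rewrite !ge0_integralZr//; first by rewrite ge0_integral_lebesgue_shift.
all: by rewrite ?lee_fin ?normal_peak_ge0.
Qed.
End standard_normal.

Lemma tnth_rcons_lt (T : Type) n (t : n.-tuple T) x (i : 'I_n.+1)
  (ilt : (i < n)%N) : tnth (rcons_tuple t x) i = tnth t (Ordinal ilt).
Proof. by rewrite !(tnth_nth x) /= nth_rcons size_tuple ilt. Qed.

Lemma tnth_rcons_max (T : Type) n (t : n.-tuple T) x :
  tnth (rcons_tuple t x) ord_max = x.
Proof. by rewrite (tnth_nth x) /= nth_rcons size_tuple ltnn eqxx. Qed.

Section iid.
Local Open Scope ereal_scope.
Context {R : realType}.
Local Notation N01 := (@normal_prob R 0%R 1%R).

Lemma ge0_integral_iid_normalS n (f : n.+1.-tuple R -> \bar R) :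
  measurable_fun setT f -> (forall t, 0 <= f t) ->
  \int[iid_normal n.+1]_t f t =
  \int[iid_normal n]_t \int[N01]_x f (rcons_tuple t x).
Proof.
move=> mf f0; rewrite /= ge0_integral_distribution//.
transitivity (\int[(iid_normal n \x N01)%E]_p (f \o @rcons_real R n) p).
  by apply: eq_measure_integral.
rewrite fubini_tonelli1//=.
exact: measurableT_comp.
Qed.

(** The shift is indexed by [nat] so that one and the same [a] serves all lengths in an induction on
    [n]. *)
Definition shift_tuple (a : nat -> R) n (t : n.-tuple R) : n.-tuple R :=
  [tuple (tnth t i + a i)%R | i < n].

Lemma measurable_shift_tuple a n : measurable_fun setT (@shift_tuple a n).
Proof.
apply/measurable_fun_tnthP => i.
rewrite (_ : _ \o _ = fun t : n.-tuple R => tnth t i + a i)%R; last first.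
  by apply/funext => t /=; rewrite tnth_mktuple.
by apply: measurable_funD => //; exact: measurable_tnth.
Qed.

Lemma shift_tuple_rcons a n (t : n.-tuple R) x :
  shift_tuple a (rcons_tuple t x) = rcons_tuple (shift_tuple a t) (x + a n)%R.
Proof.
apply: eq_from_tnth => i; rewrite tnth_mktuple; have [ilt|ige] := ltnP i n.
  by rewrite !(tnth_rcons_lt _ _ ilt) tnth_mktuple.
have -> : i = ord_max by apply/val_inj/eqP; rewrite eqn_leq ige -ltnS ltn_ord.
by rewrite !tnth_rcons_max.
Qed.

Definition sumsq (s : seq R) : R := (\sum_(x <- s) x ^+ 2)%R.

Lemma sumsq_rcons s x : sumsq (rcons s x) = (sumsq s + x ^+ 2)%R.
Proof. by rewrite /sumsq big_rcons. Qed.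

Lemma measurable_sumsq n : measurable_fun setT (fun t : n.-tuple R => sumsq t).
Proof.
rewrite (_ : (fun _ => _) = fun t : n.-tuple R => \sum_(i < n) tnth t i ^+ 2)%R.
  apply: measurable_sum => i; apply: measurable_funX; exact: measurable_tnth.
by apply/funext => t; rewrite /sumsq big_tuple.
Qed.

Lemma iid_normal_shift a n (f : n.-tuple R -> \bar R) :
  measurable_fun setT f -> (forall t, 0 <= f t) ->
  \int[iid_normal n]_t (f (shift_tuple a t) * (expR (sumsq t / 2))%:E) =
  \int[iid_normal n]_t (f t * (expR (sumsq t / 2))%:E).
Proof.
elim: n f => [|n IHn] f mf f0.
  by congr integral; apply/funext => t; rewrite (tuple0 t) (tuple0 (shift_tuple _ _)).
have me k : measurable_fun setT (fun t : k.-tuple R => (expR (sumsq t / 2))%:E).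
  apply/measurable_EFinP/measurableT_comp => //.
  by apply: measurable_funM => //; exact: measurable_sumsq.
have me1 : measurable_fun setT (fun x : measurableTypeR R => (expR (x ^+ 2 / 2))%:E).
  apply/measurable_EFinP/measurableT_comp => //; exact: (@measurable_funM _ R R).
have e0 (r : R) : 0 <= (expR r)%:E by rewrite lee_fin expR_ge0.
rewrite !ge0_integral_iid_normalS; last 4 first.
- exact: emeasurable_funM mf (me _).
- by move=> t; rewrite mule_ge0.
- apply: emeasurable_funM (me _).
  exact: (measurableT_comp mf (@measurable_shift_tuple a n.+1)).
- by move=> t; rewrite mule_ge0.
have mrc t : measurable_fun setT (fun x : measurableTypeR R => f (rcons_tuple t x)).
  apply: (measurableT_comp mf).
  exact: (measurableT_comp (@measurable_funPT _ _ _ _ (@rcons_real R n)) (measurable_pair1 t)).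
pose g t := \int[N01]_x (f (rcons_tuple t x) * (expR (x ^+ 2 / 2))%:E).
have mg : measurable_fun setT g.
  apply: (@measurable_fun_fubini_tonelli_F _ _ _ _ _ N01
    (fun p => f (rcons_real p) * (expR (p.2 ^+ 2 / 2))%:E)).
    apply: emeasurable_funM; first exact: measurableT_comp.
    exact: (measurableT_comp me1 measurable_snd).
  by move=> p; rewrite mule_ge0.
have g0 t : 0 <= g t by apply: integral_ge0 => x _; rewrite mule_ge0.
transitivity (\int[iid_normal n]_t (g (shift_tuple a t) * (expR (sumsq t / 2))%:E)).
  apply: eq_integral => t _; rewrite /g.
  rewrite -(@standard_normal_shift _ (a n) (fun x => f (rcons_tuple (shift_tuple a t) x)))//.
  rewrite -ge0_integralZr//.
  - apply: eq_integral => x _; rewrite shift_tuple_rcons sumsq_rcons mulrDl expRD EFinM.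
    by rewrite muleAC muleA.
  - apply: emeasurable_funM me1.
    exact: (measurableT_comp (mrc _) (measurable_shiftR _)).
  - by move=> x _; rewrite mule_ge0.
rewrite IHn//; apply: eq_integral => t _; rewrite /g -ge0_integralZr//.
- apply: eq_integral => x _; rewrite sumsq_rcons mulrDl expRD EFinM.
  by rewrite muleAC muleA.
- exact: emeasurable_funM.
- by move=> x _; rewrite mule_ge0.
Qed.

End iid.

(** * A translation-invariant integral on column vectors *)

Section lebint.
Local Open Scope ereal_scope.
Context {R : realType}.

Lemma measurable_fun_dotc d (T : measurableType d) n (f g : T -> 'cV[R]_n) :
  measurable_fun setT f -> measurable_fun setT g ->
  measurable_fun setT (fun t => dotc (f t) (g t)).
Proof.
move=> mf mg; under eq_fun do rewrite dotcE.
apply: measurable_sum => i; apply: measurable_funM.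
  exact: (measurableT_comp (measurable_coord i) mf).
exact: (measurableT_comp (measurable_coord i) mg).
Qed.

(** This is [(2 pi)^(-n/2)] times the Lebesgue integral, the normalisation for which
    [exp (- |z|^2 / 2)] has integral one. *)
Definition lebint n (f : 'cV[R]_n -> \bar R) : \bar R :=
  \int[std_gaussian n]_z (f z * (expR (dotc z z / 2))%:E).

Lemma eq_lebint n (f g : 'cV[R]_n -> \bar R) : f =1 g -> lebint f = lebint g.
Proof. by move=> /funext ->. Qed.

Let w n (z : 'cV[R]_n) : \bar R := (expR (dotc z z / 2))%:E.

Let w_ge0 n (z : 'cV[R]_n) : 0 <= w z.
Proof. by rewrite lee_fin expR_ge0. Qed.

Let mw n : measurable_fun setT (@w n).
Proof.
apply/measurable_EFinP/measurableT_comp => //; apply: measurable_funM => //.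
exact: measurable_fun_dotc.
Qed.

Lemma dotc_col_of_tuple n (t : n.-tuple R) :
  dotc (col_of_tuple t) (col_of_tuple t) = sumsq t.
Proof.
by rewrite dotcE /sumsq big_tuple; apply: eq_bigr => i _; rewrite !mxE.
Qed.

Lemma lebint_shift n (a : 'cV[R]_n) f :
  measurable_fun setT f -> (forall z, 0 <= f z) ->
  lebint (fun z : 'cV[R]_n => f (z + a)%R) = lebint f.
Proof.
move=> mf f0.
have mfa : measurable_fun setT (fun z : 'cV[R]_n => f (z + a)%R).
  apply: (measurableT_comp mf); exact: measurable_fun_addmx.
rewrite /lebint !ge0_integral_distribution; last 4 first.
- exact: emeasurable_funM mf (@mw n).
- by move=> z; exact: mule_ge0 (f0 _) (w_ge0 _).
- exact: emeasurable_funM mfa (@mw n).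
- by move=> z; exact: mule_ge0 (f0 _) (w_ge0 _).
pose b k : R := if @insub _ _ 'I_n k is Some i then a i ord0 else 0%R.
transitivity (\int[iid_normal n]_t
    ((f \o @col_of_tuple R n) (shift_tuple b t) * (expR (sumsq t / 2))%:E)).
  apply: eq_integral => t _ /=; rewrite dotc_col_of_tuple; congr (f _ * _).
  by apply/matrixP => i j; rewrite !mxE tnth_mktuple /b valK (ord1 j).
rewrite iid_normal_shift; last 2 first.
- exact: (measurableT_comp mf (@measurable_funPT _ _ _ _ (@col_of_tuple R n))).
- by move=> t; exact: f0.
by apply: eq_integral => t _ /=; rewrite dotc_col_of_tuple.
Qed.

Lemma lebint_gauss n : lebint (fun z : 'cV[R]_n => (expR (- (dotc z z / 2)))%:E) = 1.
Proof.
rewrite /lebint; under eq_integral do rewrite -EFinM -expRD addNr expR0.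
by rewrite integral_cst// mul1e; exact: probability_setT.
Qed.

(* Uniqueness of Haar measure: Tonelli, and translation invariance of both
   functionals [lebint] and [fun f => lebint (f \o mulmx M)]. *)
Let haar_swap n (M : 'M[R]_n) (f g : 'cV[R]_n -> \bar R) : M \in unitmx ->
  measurable_fun setT f -> (forall z, 0 <= f z) ->
  measurable_fun setT g -> (forall z, 0 <= g z) -> (forall z, g (- z)%R = g z) ->
  lebint (fun x => f (M *m x)) * lebint g = lebint f * lebint (fun x => g (M *m x)).
Proof.
move=> Mu mf f0 mg g0 g_even.
pose mM := @measurable_fun_mulmx R _ _ n n M.
have nu_shift (h : 'cV[R]_n -> \bar R) y : measurable_fun setT h -> (forall z, 0 <= h z) ->
    lebint (fun x => h (M *m x + y)%R) = lebint (fun x => h (M *m x)).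
  move=> mh h0; rewrite -[RHS](@lebint_shift _ (invmx M *m y)).
  - by apply: eq_lebint => x; rewrite mulmxDr mulKVmx.
  - by apply: (measurableT_comp mh); exact: mM.
  - by move=> z.
have lebint_ge0 (h : 'cV[R]_n -> \bar R) : (forall z, 0 <= h z) -> 0 <= @lebint n h.
  by move=> h0; apply: integral_ge0 => z _; exact: mule_ge0 (h0 _) (w_ge0 _).
have mx : measurable_fun setT (fun p : 'cV[R]_n * 'cV[R]_n => p.1) by exact: measurable_fst.
have my : measurable_fun setT (fun p : 'cV[R]_n * 'cV[R]_n => p.2) by exact: measurable_snd.
have mMxy : measurable_fun setT (fun p : 'cV[R]_n * 'cV[R]_n => M *m p.1 + p.2)%R.
  by apply: measurable_fun_addmx => //; exact: mM.
have mMxy' : measurable_fun setT (fun p : 'cV[R]_n * 'cV[R]_n => M *m p.1 + (- 1%:M *m p.2))%R.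
  by apply: measurable_fun_addmx; [exact: (mM _ _ _ mx)|exact: measurable_fun_mulmx my].
have mfw : measurable_fun setT (fun z => f z * w z) by exact: emeasurable_funM mf (@mw n).
have mgw : measurable_fun setT (fun z => g z * w z) by exact: emeasurable_funM mg (@mw n).
have fw0 z : 0 <= f z * w z by exact: mule_ge0.
have gw0 z : 0 <= g z * w z by exact: mule_ge0.
(* For fixed [x], the translation of [y] by [- M x] and the evenness of [g] turn the integral of [F]
   in [y] into that of [G]. Integrated in [x] before [y], [F] gives the left product and [G] the
   right one. *)
pose F (p : 'cV[R]_n * 'cV[R]_n) := f (M *m p.1 + p.2)%R * w p.1 * (g p.2 * w p.2).
pose G (p : 'cV[R]_n * 'cV[R]_n) := g (M *m p.1 + (- 1%:M *m p.2))%R * w p.1 * (f p.2 * w p.2).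
have mF : measurable_fun setT F.
  apply: emeasurable_funM; last exact: (measurableT_comp mgw).
  by apply: emeasurable_funM; [exact: (measurableT_comp mf)|exact: (measurableT_comp (@mw n))].
have mG : measurable_fun setT G.
  apply: emeasurable_funM; last exact: (measurableT_comp mfw).
  by apply: emeasurable_funM; [exact: (measurableT_comp mg)|exact: (measurableT_comp (@mw n))].
have F0 p : 0 <= F p by rewrite !mule_ge0.
have G0 p : 0 <= G p by rewrite !mule_ge0.
transitivity (\int[std_gaussian n]_y \int[std_gaussian n]_x F (x, y)).
  rewrite -[lebint g]/(\int[_]_z _) -ge0_integralZl//; last exact: lebint_ge0.
  apply: eq_integral => y _; rewrite -(nu_shift f y)// -ge0_integralZr//.
    apply: emeasurable_funM (@mw n); apply: (measurableT_comp mf).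
    by apply: measurable_fun_addmx => //; exact: mM.
  by move=> x _; rewrite mule_ge0.
rewrite -fubini_tonelli//.
transitivity (\int[std_gaussian n]_x \int[std_gaussian n]_y G (x, y)).
  apply: eq_integral => x _.
  pose h (y : 'cV[R]_n) := f y * g (M *m x + (- 1%:M *m y))%R.
  have mh : measurable_fun setT h.
    apply: emeasurable_funM => //; apply: (measurableT_comp mg).
    by apply: measurable_fun_addmx => //; exact: measurable_fun_mulmx.
  have h0 y : 0 <= h y by exact: mule_ge0.
  have mhs : measurable_fun setT (fun y : 'cV[R]_n => h (y + M *m x)%R).
    by apply: (measurableT_comp mh); exact: measurable_fun_addmx.
  transitivity (w x * lebint (fun y : 'cV[R]_n => h (y + M *m x)%R)).
    rewrite /lebint -ge0_integralZl//; last 2 first.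
    - exact: emeasurable_funM mhs (@mw n).
    - by move=> y _; rewrite mule_ge0.
    apply: eq_integral => y _; rewrite /F /h /= mulmxDr mulNmx mul1mx addrA.
    rewrite mulNmx mul1mx addrAC addrN add0r g_even.
    by rewrite (addrC y) -/(w y) -!muleA; rewrite muleCA.
  rewrite lebint_shift// /lebint -ge0_integralZl//; last 2 first.
  - exact: emeasurable_funM mh (@mw n).
  - by move=> y _; rewrite mule_ge0.
  apply: eq_integral => y _; rewrite /G /h /= -/(w y).
  by rewrite -!muleA muleCA [RHS]muleCA; congr (_ * _); rewrite muleCA.
rewrite fubini_tonelli// -[lebint f]/(\int[_]_z _) -ge0_integralZr//; last exact: lebint_ge0.
apply: eq_integral => y _.
have gy := nu_shift g (- 1%:M *m y)%R mg g0.
rewrite -[X in _ * X]gy -[RHS]ge0_integralZl.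
- by apply: eq_integral => x _; rewrite /G /= muleC.
- exact: measurableT.
- apply: emeasurable_funM (@mw n); apply: (measurableT_comp mg).
  by apply: measurable_fun_addmx => //; exact: mM.
- by move=> x _; rewrite mule_ge0.
- exact: fw0.
Qed.

(* The constant is [lebint (g \o mulmx M)] for [g] the Gaussian function; applying
   [haar_swap] to [g \o mulmx M^-1] shows that it is finite and nonzero. *)
Lemma lebint_mulmx n (M : 'M[R]_n) : M \in unitmx ->
  exists2 c : R, (0 < c)%R & forall f, measurable_fun setT f -> (forall z, 0 <= f z) ->
    lebint (fun x => f (M *m x)) = c%:E * lebint f.
Proof.
move=> Mu; pose g (z : 'cV[R]_n) := (expR (- (dotc z z / 2)))%:E : \bar R.
have mg : measurable_fun setT g.
  apply/measurable_EFinP/measurableT_comp => //; apply: measurableT_comp => //.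
  by apply: measurable_funM => //; exact: measurable_fun_dotc.
have g0 z : 0 <= g z by rewrite lee_fin expR_ge0.
have g_even z : g (- z)%R = g z by rewrite /g dotcNl dotcNr opprK.
have lebint_ge0 (h : 'cV[R]_n -> \bar R) : (forall z, 0 <= h z) -> 0 <= lebint h.
  by move=> h0; apply: integral_ge0 => z _; exact: mule_ge0 (h0 _) (w_ge0 _).
have swap f mf f0 := @haar_swap n M f g Mu mf f0 mg g0 g_even.
have lg1 : lebint g = 1 by exact: lebint_gauss.
have mgV : measurable_fun setT (fun x : 'cV[R]_n => g (invmx M *m x)).
  by apply: (measurableT_comp mg); exact: measurable_fun_mulmx.
pose a := lebint (fun x : 'cV[R]_n => g (invmx M *m x)).
pose b := lebint (fun x : 'cV[R]_n => g (M *m x)).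
have ab1 : a * b = 1.
  rewrite -[LHS](swap _ mgV (fun z => g0 _)) lg1 mule1 -[RHS]lg1.
  by apply: eq_lebint => x; rewrite mulKmx.
have a0 : 0 <= a by exact: lebint_ge0.
have b0 : 0 <= b by exact: lebint_ge0.
have [r bE] : exists r, b = r%:E.
  move: (a) (b) a0 b0 ab1 => {}a [r|a0 _|]//; first by exists r.
  move: a0; rewrite le_eqVlt => /predU1P[<-|a0].
    by rewrite mul0e => /eqP; rewrite eq_sym onee_eq0.
  by rewrite gt0_muley.
exists r; last by move=> f mf f0; have := swap f mf f0; rewrite lg1 mule1 -/b bE muleC.
rewrite -lte_fin -bE lt0e b0 andbT; apply: contra_eq_neq ab1 => ->.
by rewrite mule0 eq_sym onee_neq0.
Qed.

End lebint.

Section gaussian_integral.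
Local Open Scope ereal_scope.
Context {R : realType}.

Definition quad n (S : 'M[R]_n) (a x : 'cV[R]_n) : R :=
  (dotc (x - a) (S *m (x - a)) / 2)%R.

Definition gexp n (S : 'M[R]_n) (a x : 'cV[R]_n) : R := expR (- quad S a x).

Lemma gexp_ge0 n S a x : (0 <= @gexp n S a x)%R.
Proof. exact: expR_ge0. Qed.

Lemma lebint_ge0 n (h : 'cV[R]_n -> \bar R) : (forall z, 0 <= h z) -> 0 <= lebint h.
Proof.
by move=> h0; apply: integral_ge0 => z _; rewrite mule_ge0// lee_fin expR_ge0.
Qed.

Lemma lebintZl n (c : R) (h : 'cV[R]_n -> \bar R) : (0 <= c)%R ->
  measurable_fun setT h -> (forall z, 0 <= h z) ->
  lebint (fun z => c%:E * h z) = c%:E * lebint h.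
Proof.
move=> c0 mh h0; rewrite /lebint -ge0_integralZl//.
- by apply: eq_integral => z _; rewrite muleA.
- apply: emeasurable_funM => //; apply/measurable_EFinP/measurableT_comp => //.
  by apply: measurable_funM => //; exact: measurable_fun_dotc.
- by move=> z _; rewrite mule_ge0// lee_fin expR_ge0.
Qed.

Lemma measurable_quad d (T : measurableType d) n (S : 'M[R]_n) (f g : T -> 'cV[R]_n) :
  measurable_fun setT f -> measurable_fun setT g ->
  measurable_fun setT (fun t => quad S (f t) (g t)).
Proof.
move=> mf mg; apply: measurable_funM => //.
have md : measurable_fun setT (fun t => g t - f t)%R.
  rewrite (_ : (fun _ => _) = fun t => g t + (- 1%:M *m f t))%R.
    by apply: measurable_fun_addmx => //; exact: measurable_fun_mulmx.
  by apply/funext => t; rewrite mulNmx mul1mx.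
by apply: measurable_fun_dotc => //; exact: measurable_fun_mulmx.
Qed.

Lemma measurable_gexp d (T : measurableType d) n (S : 'M[R]_n) (f g : T -> 'cV[R]_n) :
  measurable_fun setT f -> measurable_fun setT g ->
  measurable_fun setT (fun t => gexp S (f t) (g t)).
Proof.
move=> mf mg; apply: measurableT_comp => //; apply: measurableT_comp => //.
exact: measurable_quad.
Qed.

Lemma measurable_Egexp n (S : 'M[R]_n) a :
  measurable_fun setT (fun x => (gexp S a x)%:E).
Proof. by apply/measurable_EFinP; exact: measurable_gexp. Qed.

Lemma mul_gexp_ge0 n (S : 'M[R]_n) a x (y : \bar R) : 0 <= y -> 0 <= y * (gexp S a x)%:E.
Proof. by move=> y0; rewrite mule_ge0// lee_fin gexp_ge0. Qed.

(** Substitution [x = a + S^(1/2) z]. The constant precedes the quantifier over [a]: for a policy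
    the mean moves with the state, and the normalising factor must not. *)
Lemma ge0_integral_gaussian n (S : 'M[R]_n) : pdmx S ->
  exists2 c : R, (0 < c)%R & forall a f, measurable_fun setT f -> (forall x, 0 <= f x) ->
    \int[gaussian a S]_x f x = c%:E * lebint (fun x => f x * (gexp (invmx S) a x)%:E).
Proof.
move=> Spd; have Nu := sqrtmx_unit Spd; have [c c0 hc] := lebint_mulmx Nu.
exists c => // a f mf f0.
rewrite ge0_integral_distribution//.
set h := fun x => f x * (gexp (invmx S) a x)%:E.
have mh : measurable_fun setT h by apply: emeasurable_funM => //; exact: measurable_Egexp.
have h0 x : 0 <= h x by exact: mul_gexp_ge0.
have mha : measurable_fun setT (fun x : 'cV[R]_n => h (x + a)%R).
  by apply: (measurableT_comp mh); exact: measurable_fun_addmx.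
rewrite -[X in _ * X](lebint_shift a mh h0) -[RHS](hc _ mha (fun=> h0 _)).
apply: eq_integral => z _ /=; rewrite /h addrC -muleA -EFinM /gexp /quad addrAC subrr add0r.
rewrite (_ : dotc _ _ = dotc z z); first by rewrite -expRD addNr expR0 mule1.
have SE : invmx S = invmx (sqrtmx S) *m invmx (sqrtmx S).
  by rewrite -invmx_mul// sqrtmx_sqr//; exact: pd_psdmx.
rewrite SE -mulmxA mulKmx// dotc_mulr trmx_inv tr_sqrtmx ?mulKmx//.
exact: pd_psdmx.
Qed.

Lemma gaussian_density n (S S' : 'M[R]_n) : pdmx S -> pdmx S' ->
  exists2 c : R, (0 < c)%R & forall a a' f, measurable_fun setT f -> (forall x, 0 <= f x) ->
    \int[gaussian a S]_x f x = \int[gaussian a' S']_x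
      (f x * (c * expR (quad (invmx S') a' x - quad (invmx S) a x))%:E).
Proof.
move=> Spd S'pd; have [c c0 hc] := ge0_integral_gaussian Spd.
have [c' c'0 hc'] := ge0_integral_gaussian S'pd.
exists (c / c')%R; first exact: divr_gt0.
move=> a a' f mf f0; rewrite hc// hc'; last 2 first.
- apply: emeasurable_funM => //; apply/measurable_EFinP/measurable_funM => //.
  by apply: measurableT_comp => //; apply: measurable_funB; exact: measurable_quad.
- by move=> x; rewrite mule_ge0// lee_fin mulr_ge0 ?expR_ge0// divr_ge0// ltW.
transitivity (c'%:E * lebint (fun x => (c / c')%:E * (f x * (gexp (invmx S) a x)%:E))).
  rewrite lebintZl ?divr_ge0 ?ltW//.
  - by rewrite muleA -EFinM mulrC divfK// gt_eqF.
  - by apply: emeasurable_funM => //; exact: measurable_Egexp.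
  - by move=> x; exact: mul_gexp_ge0.
congr (_ * _); apply: eq_lebint => x.
rewrite -[RHS]muleA -EFinM -(mulrA (c / c')%R) /gexp -expRD addrAC subrr add0r.
by rewrite EFinM muleCA.
Qed.

(** The value at the constant 1 determines the factor [c], so it need not be computed. It is allowed
    to be an extended real; infinite values are excluded because the Gaussian weight has positive
    finite integral. *)
Lemma eq_gaussian n (S : 'M[R]_n) (a : 'cV[R]_n)
    (I : ('cV[R]_n -> \bar R) -> \bar R) (c : \bar R) :
  pdmx S -> I (cst 1) = 1 ->
  (forall f, measurable_fun setT f -> (forall x, 0 <= f x) ->
    I f = c * lebint (fun x => f x * (gexp (invmx S) a x)%:E)) ->
  forall f, measurable_fun setT f -> (forall x, 0 <= f x) ->
    I f = \int[gaussian a S]_x f x.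
Proof.
move=> Spd I1 hI f mf f0; have [c' c'0 hc'] := ge0_integral_gaussian Spd.
rewrite hI// hc'//; congr (_ * _).
have := hI (cst 1) (measurable_cst _) (fun=> lee01); rewrite I1.
have := hc' a (cst 1) (measurable_cst _) (fun=> lee01).
rewrite integral_cst// mul1e [X in X = _ -> _](_ : _ = 1); last first.
  exact: probability_setT.
set L := lebint _.
case: L => [l||]; last 2 first.
- by rewrite gt0_muley.
- by rewrite gt0_muleNy.
move=> /eqP; rewrite -EFinM eqe => /eqP cl.
have l0 : (0 < l)%R by rewrite -(pmulr_lgt0 _ c'0) mulrC -cl.
case: c {hI} => [c||].
- move=> /eqP; rewrite -EFinM eqe {1}cl => /eqP E; congr EFin.
  by apply: (mulIf (lt0r_neq0 l0)); rewrite -E.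
- by rewrite gt0_mulye.
- by rewrite gt0_mulNye.
Qed.

End gaussian_integral.

Section complete_square.
Context {R : realType}.

(** Bayes' rule for a Gaussian pair: on the left [w] is standard and [y] given [w] is [N(D w, S)];
    on the right [y] is [N(0, S + D D^T)] and [w] given [y] has mean [L y] and precision [J]. *)
Lemma complete_square n m (S : 'M[R]_n) (D : 'M[R]_(n, m)) : pdmx S ->
  let P := invmx S in let J := 1%:M + D^T *m P *m D in
  let L := invmx J *m D^T *m P in
  forall y w, dotc (y - D *m w) (P *m (y - D *m w)) + dotc w w =
  dotc (w - L *m y) (J *m (w - L *m y)) + dotc y (invmx (S + D *m D^T) *m y).
Proof.
move=> Spd P J L y w.
have Su := pdmx_unit Spd; have PT : P^T = P by rewrite trmx_inv (pdmx_sym Spd).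
have Jpd : pdmx J.
  apply: pdmxDr; first exact: pdmx1.
  rewrite -[X in _ *m _ *m X]trmxK; apply: psdmx_congr.
  by apply: pd_psdmx; exact: pdmx_inv.
have JT := pdmx_sym Jpd.
have JL : J *m L = D^T *m P by rewrite /L -!mulmxA mulKVmx// pdmx_unit.
have S'u : S + D *m D^T \in unitmx.
  by apply: pdmx_unit; apply: pdmxDr => //; exact: psdmx_gram.
have -> : invmx (S + D *m D^T) *m y = P *m (y - D *m (L *m y)).
  apply: (can_inj (mulKmx S'u)); rewrite mulKVmx//.
  rewrite !mulmxBr mulmxA mulmxDl mulmxV// mulmxDl mul1mx mulmxA.
  rewrite mulmxDl mulmxV// mulmxDl mul1mx.
  have -> : D *m D^T *m P *m (D *m (L *m y)) = D *m (J *m L) *m y - D *m (L *m y).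
    move: (L) => L'; rewrite /J mulmxDl mul1mx mulmxDr mulmxDl !mulmxA.
    by rewrite addrAC subrr add0r.
  by rewrite JL [X in _ - X]addrC subrK !mulmxA addrK.
have e1 : dotc w (J *m (L *m y)) = dotc (D *m w) (P *m y).
  by rewrite mulmxA JL dotc_mull !mulmxA.
have e2 : dotc (L *m y) (J *m (L *m y)) = dotc (D *m (L *m y)) (P *m y).
  by rewrite mulmxA JL (dotc_mull D) !mulmxA.
have e3 : dotc w (J *m w) = dotc w w + dotc (D *m w) (P *m (D *m w)).
  by rewrite /J mulmxDl mul1mx dotcDr [in RHS]dotc_mull !mulmxA.
have e4 : dotc (L *m y) (J *m w) = dotc w (J *m (L *m y)).
  by rewrite dotc_mulr JT dotcC.
have e5 : dotc y (P *m (D *m w)) = dotc (D *m w) (P *m y).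
  by rewrite dotc_mulr PT dotcC.
have e6 : dotc y (P *m (D *m (L *m y))) = dotc (D *m (L *m y)) (P *m y).
  by rewrite dotc_mulr PT dotcC.
rewrite !mulmxBr !(dotcDl, dotcDr, dotcNl, dotcNr) e4 e1 e2 e3 e5 e6.
ring.
Qed.

End complete_square.

Section gaussian_affine.
Local Open Scope ereal_scope.
Context {R : realType}.

(** The noise [B u] may be degenerate and have no density, so the density is produced by the state:
    for a fixed value [w] of the noise, [F x + D w] with [F = A + B K] invertible is Gaussian with
    mean [D w]. Then [w] is integrated out by [complete_square]. *)
Lemma gaussian_affine n m (A S : 'M[R]_n) (B : 'M[R]_(n, m)) (K : 'M[R]_(m, n))
    (U : 'M[R]_m) :
  pdmx S -> pdmx U -> (A + B *m K)%R \in unitmx ->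
  forall f : 'cV[R]_n -> \bar R, measurable_fun setT f -> (forall x, 0 <= f x) ->
  \int[gaussian 0 S]_x \int[gaussian (K *m x) U]_u f (A *m x + B *m u)%R =
  \int[gaussian 0 ((A + B *m K) *m S *m (A + B *m K)^T + B *m U *m B^T)%R]_x f x.
Proof.
set F := (A + B *m K)%R => Spd Upd Fu.
pose N := sqrtmx U; pose D := B *m N.
have -> : B *m U *m B^T = D *m D^T.
  have Upsd := pd_psdmx Upd.
  rewrite /D trmx_mul /N (tr_sqrtmx Upsd) mulmxA -(mulmxA B (sqrtmx U)).
  by rewrite (sqrtmx_sqr Upsd).
pose S1 := F *m S *m F^T.
have S1pd : pdmx S1 by exact: pdmx_congr.
pose J := (1%:M + D^T *m invmx S1 *m D)%R.
pose L := invmx J *m D^T *m invmx S1.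
have [c c0 hc] := ge0_integral_gaussian Spd.
have [c' c'0 hc'] := lebint_mulmx Fu.
set S' := (S1 + D *m D^T)%R.
have S'pd : pdmx S' by apply: pdmxDr => //; exact: psdmx_gram.
pose kappa := lebint (fun w => (gexp J 0 w)%:E).
have affE x z : (A *m x + B *m gaussian_map (K *m x) U z = F *m x + D *m z)%R.
  by rewrite /gaussian_map mulmxDr !mulmxA addrA -mulmxDl.
have mJ : measurable_fun setT (fun w => (gexp J 0 w)%:E) by exact: measurable_Egexp.
have mFD : measurable_fun setT (fun p : 'cV[R]_m * 'cV[R]_n => F *m p.2 + D *m p.1)%R.
  by apply: measurable_fun_addmx; apply: measurable_fun_mulmx;
    [exact: measurable_snd|exact: measurable_fst].
have mFD' : measurable_fun setT (fun p : 'cV[R]_n * 'cV[R]_m => F *m p.1 + D *m p.2)%R.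
  by apply: measurable_fun_addmx; apply: measurable_fun_mulmx;
    [exact: measurable_fst|exact: measurable_snd].
have inner (f : 'cV[R]_n -> \bar R) x : measurable_fun setT f -> (forall x, 0 <= f x) ->
    \int[gaussian (K *m x) U]_u f (A *m x + B *m u)%R =
    \int[std_gaussian m]_w f (F *m x + D *m w)%R.
  move=> mf f0; rewrite ge0_integral_distribution//.
    by apply: eq_integral => w _ /=; rewrite affE.
  apply: (measurableT_comp mf); apply: measurable_fun_addmx => //.
  exact: measurable_fun_mulmx.
apply: (eq_gaussian (I := fun f => \int[gaussian 0 S]_x
  \int[gaussian (K *m x) U]_u f (A *m x + B *m u)%R) (c := c%:E * c'%:E * kappa)) => //.
  have int1 k (Q : probability 'cV[R]_k R) : \int[Q]_x cst 1 x = 1.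
    by rewrite integral_cst// mul1e; exact: probability_setT.
  rewrite -[RHS](int1 n (gaussian 0 S)); apply: eq_integral => x _.
  exact: (int1 m).
move=> f mf f0.
under eq_integral do rewrite inner//.
rewrite (@fubini_tonelli _ _ _ _ _ (gaussian 0 S) (std_gaussian m)
  (fun p => f (F *m p.1 + D *m p.2)%R))//=; last first.
  exact: (measurableT_comp mf mFD').
pose g w (y : 'cV[R]_n) := f y * (gexp (invmx S1) (D *m w) y)%:E.
have mg w : measurable_fun setT (g w).
  by apply: emeasurable_funM => //; exact: measurable_Egexp.
have g0 w y : 0 <= g w y by exact: mul_gexp_ge0.
transitivity (\int[std_gaussian m]_w (c%:E * c'%:E * lebint (g w))).
  apply: eq_integral => w _.
  have mfw : measurable_fun setT (fun x => f (F *m x + D *m w)%R).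
    by apply: (measurableT_comp mf); apply: measurable_fun_addmx => //; exact: measurable_fun_mulmx.
  rewrite [LHS](hc 0%R _ mfw (fun x => f0 _)) -muleA; congr (_ * _).
  have mgw : measurable_fun setT (fun y : 'cV[R]_n => g w (y + D *m w)%R).
    by apply: (measurableT_comp (mg w)); exact: measurable_fun_addmx.
  have := hc' _ mgw (fun x => g0 _ _).
  rewrite [X in _ = _ * X -> _](lebint_shift _ (mg w) (g0 w)) => <-.
  apply: eq_lebint => x; rewrite /g /gexp /quad (subr0 x) (addrK (D *m w) (F *m x)).
  congr (_ * (expR (- (_ / 2)))%:E).
  have -> : invmx S1 *m (F *m x) = (invmx F)^T *m (invmx S *m x).
    apply: (can_inj (mulKmx (pdmx_unit S1pd))); rewrite mulKVmx ?pdmx_unit//.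
    have FTu : F^T \in unitmx by rewrite unitmx_tr.
    by rewrite trmx_inv -!mulmxA mulKVmx// mulKVmx// pdmx_unit.
  by rewrite dotc_mull trmx_inv mulKVmx ?unitmx_tr.
(* After completing the square the weight in [w] is centred at [L y]; a translation removes the
   centre, so the factor [kappa] does not depend on [y]. *)
have inner_int y : \int[std_gaussian m]_w (gexp (invmx S1) (D *m w) y)%:E =
    (gexp (invmx S') 0 y)%:E * kappa.
  have J0 z : 0 <= (gexp J 0 z)%:E by rewrite lee_fin gexp_ge0.
  rewrite /kappa -(lebint_shift (- (L *m y))%R mJ J0).
  rewrite -lebintZl ?gexp_ge0//; last first.
    by apply: (measurableT_comp mJ); exact: measurable_fun_addmx.
  apply: eq_integral => w _; rewrite /gexp -!EFinM -!expRD /quad !subr0; congr (expR _)%:E.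
  have := complete_square D S1pd y w; rewrite -/J -/L -/S'.
  by move=> /(canRL (addrK _)) ->; field.
pose e (y : 'cV[R]_n) : \bar R := (expR (dotc y y / 2))%:E.
have me : measurable_fun setT e.
  apply/measurable_EFinP/measurableT_comp => //; apply: measurable_funM => //.
  exact: measurable_fun_dotc.
have e0 y : 0 <= e y by rewrite lee_fin expR_ge0.
pose H (p : 'cV[R]_m * 'cV[R]_n) := g p.1 p.2 * e p.2.
have H0 p : 0 <= H p by exact: mule_ge0.
have mH : measurable_fun setT H.
  apply: emeasurable_funM; last exact: (measurableT_comp me measurable_snd).
  apply: emeasurable_funM; first exact: (measurableT_comp mf measurable_snd).
  apply/measurable_EFinP/measurable_gexp => //.
  by apply: measurable_fun_mulmx; exact: measurable_fst.
rewrite ge0_integralZl//; last 3 first.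
- exact: (@measurable_fun_fubini_tonelli_F _ _ _ _ _ (std_gaussian n) H).
- by move=> w _; exact: lebint_ge0.
- by rewrite -EFinM lee_fin mulr_ge0// ltW.
rewrite -!muleA; congr (_ * (_ * _)).
rewrite (@fubini_tonelli _ _ _ _ _ (std_gaussian m) (std_gaussian n) H)//.
have kappa0 : 0 <= kappa by apply: lebint_ge0 => z; rewrite lee_fin gexp_ge0.
rewrite -ge0_integralZl//; last 2 first.
- apply: emeasurable_funM => //; apply: emeasurable_funM => //.
  exact: measurable_Egexp.
- by move=> y _; rewrite mule_ge0// mul_gexp_ge0.
apply: eq_integral => y _.
transitivity (\int[std_gaussian m]_w ((gexp (invmx S1) (D *m w) y)%:E * (f y * e y))).
  by apply: eq_integral => w _; rewrite /H /g /= muleAC muleC.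
rewrite ge0_integralZr//; last 3 first.
- by apply/measurable_EFinP/measurable_gexp => //; exact: measurable_fun_mulmx.
- by move=> w _; rewrite lee_fin gexp_ge0.
- exact: mule_ge0.
by rewrite inner_int -/(e y) -!muleA muleCA; congr (_ * _); rewrite muleCA.
Qed.

End gaussian_affine.

(** * The optimal process *)

Section optimal_policy_algebra.
Context {R : realType} {n m : nat}.
Variables (T : nat) (A : nat -> 'M[R]_n) (B : nat -> 'M[R]_(n, m)).
Variables (Sini Sfin : 'M[R]_n) (Srho : nat -> 'M[R]_m).
Hypotheses (Sini_pd : pdmx Sini) (Sfin_pd : pdmx Sfin).
Hypothesis Srho_pd : forall k, (k < T)%N -> pdmx (Srho k).
Hypothesis hA : assumptionA A (Brho B Srho) T Sini Sfin.

Local Notation b := (Brho B Srho).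
Local Notation Q := (Qrho T A B Sini Sfin Srho).
Local Notation Spi := (Spi T A B Sini Sfin Srho).
Local Notation Kpi := (Kpi T A B Sini Sfin Srho).

Definition Mrho k : 'M[R]_m := invmx (Srho k) + 1%:M.
Definition Upi k : 'M[R]_m := Mrho k + (B k)^T *m invmx (Q k.+1) *m B k.
Definition Sig k : 'M[R]_n := Sigmx A b T Sini Sfin k.

Let A_unit k : (k < T)%N -> A k \in unitmx.
Proof. by case: hA => + _ _ _; exact. Qed.

Let Gr_unit : Gr A b T 0 \in unitmx.
Proof.
by case: hA => _ [kr [/andP[_ krT] h _]] _ _; apply: h; rewrite krT leqnn.
Qed.

Let F_unit : Fmx A b T Sini Sfin \in unitmx.
Proof. by case: hA. Qed.

Let Mrho_pd k : (k < T)%N -> pdmx (Mrho k).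
Proof.
by move=> kT; apply: pdmxDr; [exact: pdmx_inv (Srho_pd kT)|exact: pd_psdmx (pdmx1 _)].
Qed.

Let bE k : b k = B k *m invmx (sqrtmx (Mrho k)). Proof. by []. Qed.

Let bb k : (k < T)%N -> b k *m (b k)^T = B k *m invmx (Mrho k) *m (B k)^T.
Proof.
move=> kT; have Mpd := Mrho_pd kT; have Lu := sqrtmx_unit Mpd.
rewrite bE trmx_mul trmx_inv (tr_sqrtmx (pd_psdmx Mpd)) mulmxA.
rewrite -(mulmxA (B k)) -invmx_mul// sqrtmx_sqr//; exact: pd_psdmx.
Qed.

Lemma Qrho_unit k : (k <= T)%N -> Q k \in unitmx.
Proof. exact: Qmx_unit. Qed.

Let Q_sym k : (Q k)^T = Q k.
Proof. exact: Qmx_sym. Qed.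

(** With [M = Mrho k], [Upi k] is the congruence of [1 + b_k^T Q_(k+1)^-1 b_k] by [M^(1/2)], because
    [b_k M^(1/2) = B_k]. *)
Lemma Upi_pd k : (k < T)%N -> pdmx (Upi k).
Proof.
move=> kT; have Mpd := Mrho_pd kT; have MT := pdmx_sym Mpd.
apply/pdmxP; split.
  by rewrite /Upi linearD /= MT !trmx_mul trmxK trmx_inv Q_sym mulmxA.
move=> x x0; have Lu := sqrtmx_unit Mpd.
pose w := sqrtmx (Mrho k) *m x.
have w0 : w != 0.
  by apply: contra_neq x0 => /(congr1 (mulmx (invmx (sqrtmx (Mrho k)))));
    rewrite mulKmx// mulmx0.
have := Qmx_form_pd Sini_pd Sfin_pd A_unit Gr_unit F_unit kT w0.
have -> : b k *m w = B k *m x by rewrite bE /w -mulmxA mulKmx.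
rewrite [X in _ + X]dotc_mulr trmxK (_ : b k *m w = B k *m x); last first.
  by rewrite bE /w -mulmxA mulKmx.
rewrite /w dotc_mull (tr_sqrtmx (pd_psdmx Mpd)) mulmxA.
rewrite (sqrtmx_sqr (pd_psdmx Mpd)).
suff -> : dotc x (Upi k *m x) = dotc x (Mrho k *m x) +
  dotc (B k *m x) (invmx (Q k.+1) *m (B k *m x)) by [].
by rewrite /Upi (mulmxDl (Mrho k)) dotcDr [in RHS](dotc_mull (B k)) !mulmxA.
Qed.

Let SpiE k : Spi k = invmx (Upi k). Proof. by []. Qed.

Lemma Spi_pd k : (k < T)%N -> pdmx (Spi k).
Proof. by move=> kT; rewrite SpiE; apply: pdmx_inv; exact: Upi_pd. Qed.

Let QSE k : (k < T)%N ->
  Q k.+1 = A k *m Q k *m (A k)^T - B k *m invmx (Mrho k) *m (B k)^T.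
Proof. by move=> kT; rewrite -bb. Qed.

Let KpiE k : Kpi k = - (invmx (Upi k) *m (B k)^T *m invmx (Q k.+1) *m A k).
Proof. by []. Qed.

Lemma closed_loop_pi_unit k : (k < T)%N -> A k + B k *m Kpi k \in unitmx.
Proof.
move=> kT; rewrite KpiE; apply: (@closed_loop_unit _ _ _ _ (Q k)) => //.
- exact: A_unit.
- exact/Qrho_unit/ltnW.
- exact: Qrho_unit.
- exact/pdmx_unit/Mrho_pd.
- exact: QSE.
- exact/pdmx_unit/Upi_pd.
Qed.

Lemma Sig_step k : (k < T)%N ->
  (A k + B k *m Kpi k) *m Sig k *m (A k + B k *m Kpi k)^T
    + B k *m Spi k *m (B k)^T = Sig k.+1.
Proof.
move=> kT; rewrite KpiE SpiE /Sig /Sigmx (@closed_loop_cov _ _ _ _ (Q k)) => //.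
- by rewrite Phi0S trmx_mul !mulmxA.
- exact: A_unit.
- exact/Qrho_unit/ltnW.
- exact: Qrho_unit.
- exact/pdmx_unit/Mrho_pd.
- exact: QSE.
- exact/pdmx_unit/Upi_pd.
Qed.

Lemma Sig0 : Sig 0 = Sini.
Proof. exact: Sigmx0. Qed.

Lemma SigT : Sig T = Sfin.
Proof. exact: SigmxT. Qed.

(** Positivity is invisible in the closed form, where [Q k] may be indefinite; it propagates along
    the recursion because the closed loop is invertible. *)
Lemma Sig_pd k : (k <= T)%N -> pdmx (Sig k).
Proof.
elim: k => [|k IHk] kT; first by rewrite Sig0.
rewrite -Sig_step//; apply: pdmxDr.
  by apply: pdmx_congr; [exact: closed_loop_pi_unit|exact/IHk/ltnW].
by apply: psdmx_congr; exact/pd_psdmx/Spi_pd.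
Qed.

(** Up to a constant, the left side is the logarithm of the density of the policy with respect to
    the prior. The summand [1] in [Mrho] is the control cost and accounts for the term
    [- |u|^2 / 2]; the other two terms telescope in [k]. *)
Lemma quad_stage k (x : 'cV[R]_n) (u : 'cV[R]_m) : (k < T)%N ->
  quad (invmx (Srho k)) 0 u - quad (invmx (Spi k)) (Kpi k *m x) u =
  quad (invmx (Q k)) 0 x - quad (invmx (Q k.+1)) 0 (A k *m x + B k *m u)
    - dotc u u / 2.
Proof.
move=> kT; rewrite /quad !subr0 SpiE invmxK KpiE.
rewrite (@stage_identity _ _ _ (A k) (Q k) (Q k.+1) (B k) (Mrho k)) => //.
- by rewrite {1}/Mrho mulmxDl mul1mx dotcDr; field.
- exact: A_unit.
- exact/Qrho_unit/ltnW.
- exact: Qrho_unit.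
- exact/pdmx_unit/Mrho_pd.
- exact/pdmx_sym/Mrho_pd.
- exact: QSE.
- exact/pdmx_unit/Upi_pd.
Qed.

End optimal_policy_algebra.

Section moore_penrose.
Context {R : realType} {n m : nat}.

(** The explicit [(B^T B)^-1 B^T] shows that a Moore-Penrose inverse exists; for the chosen one,
    [B X B = B] is then cancelled by the injectivity of [B]. *)
Lemma mpinvmx_full_col (B : 'M[R]_(n, m)) : \rank B = m -> mpinvmx B *m B = 1%:M.
Proof.
move=> rB.
have BTfree : row_free B^T by rewrite /row_free mxrank_tr rB.
have Binj k (x y : 'M[R]_(m, k)) : B *m x = B *m y -> x = y.
  move=> Bxy; apply: trmx_inj; apply: (row_free_inj BTfree).
  by rewrite -!trmx_mul Bxy.
have BBu : B^T *m B \in unitmx.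
  apply: unitmx_ker => v BBv.
  have : dotc (B *m v) (B *m v) == 0.
    by rewrite dotc_mull mulmxA BBv dotc0r.
  by rewrite dotcxx_eq0 => /eqP Bv0; apply: Binj; rewrite Bv0 mulmx0.
have Xex : exists X, is_mpinv B X.
  exists (invmx (B^T *m B) *m B^T); split.
  - by rewrite -!mulmxA mulVmx// mulmx1.
  - by rewrite -[X in X *m _ = _]mulmxA mulVmx// mul1mx.
  - by rewrite !trmx_mul trmxK trmx_inv trmx_mul trmxK mulmxA.
  - by rewrite -mulmxA mulVmx// trmx1.
have [BXB _ _ _] : is_mpinv B (mpinvmx B) by exact: (@xgetPex _ 0 [set X | is_mpinv B X]%classic Xex).
by apply: Binj; rewrite mulmx1 mulmxA.
Qed.

End moore_penrose.

Section process_integral.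
Local Open Scope ereal_scope.
Context {R : realType} {n m : nat}.
Variables (A : nat -> 'M[R]_n) (B : nat -> 'M[R]_(n, m)).
Variables (mu0 : probability 'cV[R]_n R) (pol : nat -> R.-pker 'cV[R]_n ~> 'cV[R]_m).
Local Notation law := (process_law A B mu0 pol).

Lemma ge0_integral_process0 (f : 1.-tuple 'cV[R]_n -> \bar R) :
  measurable_fun setT f -> (forall x, 0 <= f x) ->
  \int[law 0%N]_x f x = \int[mu0]_x f (traj1 x).
Proof. by move=> mf f0; rewrite /= ge0_integral_distribution. Qed.

Lemma ge0_integral_processS N (f : N.+2.-tuple 'cV[R]_n -> \bar R) :
  measurable_fun setT f -> (forall x, 0 <= f x) ->
  \int[law N.+1]_x f x = \int[law N]_x
     \int[pol N (state ord_max x)]_u f (next_state (A N) (B N) (x, u)).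
Proof. by move=> mf f0; rewrite /= ge0_integral_cond_law. Qed.

Lemma state_next_lt N (x : N.+1.-tuple 'cV[R]_n) u k (i : 'I_N.+2) (j : 'I_N.+1) :
  i = j :> nat -> state i (next_state (A k) (B k) (x, u)) = state j x.
Proof.
move=> ij; have iN : (i < N.+1)%N by rewrite ij.
by rewrite /state (tnth_rcons_lt _ _ iN); congr tnth; exact: val_inj.
Qed.

Lemma state_next_max N (x : N.+1.-tuple 'cV[R]_n) u k :
  state ord_max (next_state (A k) (B k) (x, u)) =
  (A k *m state ord_max x + B k *m u)%R.
Proof. exact: tnth_rcons_max. Qed.

Lemma state0_next N (x : N.+1.-tuple 'cV[R]_n) u k :
  state ord0 (next_state (A k) (B k) (x, u)) = state ord0 x.
Proof.
exact: state_next_lt.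
Qed.

Lemma ge0_integral_process_initial N (f : 'cV[R]_n -> \bar R) :
  measurable_fun setT f -> (forall x, 0 <= f x) ->
  \int[law N]_x f (state ord0 x) = \int[mu0]_x f x.
Proof.
move=> mf f0; have mfs k : measurable_fun setT (fun x : k.+1.-tuple 'cV[R]_n => f (state ord0 x)).
  exact: (measurableT_comp mf (@measurable_tnth _ _ _ _)).
elim: N => [|N IHN]; first by rewrite ge0_integral_process0.
rewrite ge0_integral_processS// -IHN; apply: eq_integral => x _.
under eq_integral do rewrite state0_next.
rewrite integral_cst//= (_ : pol N _ setT = 1) ?mule1//.
exact: prob_kernel.
Qed.

End process_integral.

Section process_measurability.
Local Open Scope ereal_scope.
Context d1 d2 d3 (S : measurableType d1) (X : measurableType d2)
  (U : measurableType d3) (R : realType).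

Lemma measurable_integral_kpre (h : {mfun S >-> X}) (k : R.-pker X ~> U)
    (f : S * U -> \bar R) :
  measurable_fun setT f -> (forall p, 0 <= f p) ->
  measurable_fun setT (fun s => \int[k (h s)]_u f (s, u)).
Proof.
by move=> mf f0; exact: (measurable_fun_integral_finite_kernel f (kpre h k) f0 mf).
Qed.

End process_measurability.

Section potential.
Context {R : realType} {n m : nat}.
Implicit Types (A : nat -> 'M[R]_n) (B : nat -> 'M[R]_(n, m)).

Lemma stage_potentialE (Ak : 'M[R]_n) (Bk : 'M[R]_(n, m)) x y :
  stage_potential Ak Bk x y =
  dotc (mpinvmx Bk *m (y - Ak *m x)) (mpinvmx Bk *m (y - Ak *m x)) / 2.
Proof.
rewrite /stage_potential /wnorm qformE -mulmxA dotc_mulr trmxK sqr_sqrtr ?dotcxx_ge0//.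
by rewrite mulrC mul1r.
Qed.

Lemma stage_potential_ge0 (Ak : 'M[R]_n) (Bk : 'M[R]_(n, m)) x y :
  0 <= stage_potential Ak Bk x y.
Proof. by rewrite stage_potentialE divr_ge0// dotcxx_ge0. Qed.

Lemma potential_ge0 N A B (x : N.+1.-tuple 'cV[R]_n) : 0 <= potential A B x.
Proof. by apply: sumr_ge0 => k _; exact: stage_potential_ge0. Qed.

Lemma potential0 A B (x : 1.-tuple 'cV[R]_n) : potential A B x = 0.
Proof. by rewrite /potential big_ord0. Qed.

(** The increment of the state is [B u], and full column rank lets the Moore-Penrose inverse recover
    [u]: the potential of the path is the control energy. *)
Lemma potential_next N A B (x : N.+1.-tuple 'cV[R]_n) u : \rank (B N) = m ->
  potential A B (next_state (A N) (B N) (x, u)) = potential A B x + dotc u u / 2.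
Proof.
move=> rB; rewrite /potential big_ord_recr /=; congr (_ + _).
  apply: eq_bigr => k _.
  rewrite (@state_next_lt _ _ _ _ _ _ _ _ _ _ (widen_ord (leqnSn N) k))//.
  by rewrite (@state_next_lt _ _ _ _ _ _ _ _ _ _ (lift ord0 k)).
rewrite (@state_next_lt _ _ _ _ _ _ _ _ _ _ ord_max)//.
have -> : lift ord0 ord_max = ord_max :> 'I_N.+2 by exact: val_inj.
rewrite state_next_max stage_potentialE addrC addKr mulmxA.
by rewrite mpinvmx_full_col// mul1mx.
Qed.

Lemma measurable_state N (k : 'I_N) :
  measurable_fun setT (fun x : N.-tuple 'cV[R]_n => state k x).
Proof. exact: measurable_tnth. Qed.

Lemma measurable_potential N A B :
  measurable_fun setT (fun x : N.+1.-tuple 'cV[R]_n => potential A B x).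
Proof.
apply: measurable_sum => k; under eq_fun do rewrite stage_potentialE.
apply: measurable_funM => //.
have md : measurable_fun setT (fun x : N.+1.-tuple 'cV[R]_n =>
    state (lift ord0 k) x - A k *m state (widen_ord (leqnSn N) k) x).
  under eq_fun do rewrite -mulNmx.
  apply: measurable_fun_addmx; first exact: measurable_state.
  by apply: measurable_fun_mulmx; exact: measurable_state.
by apply: measurable_fun_dotc; exact: measurable_fun_mulmx.
Qed.

End potential.

Section optimal_process.
Local Open Scope ereal_scope.
Context {R : realType} {n m : nat}.
Variables (T : nat) (A : nat -> 'M[R]_n) (B : nat -> 'M[R]_(n, m)).
Variables (Sini Sfin Sref : 'M[R]_n) (mu_ref : 'cV[R]_n) (Srho : nat -> 'M[R]_m).
Hypotheses (Sini_pd : pdmx Sini) (Sfin_pd : pdmx Sfin).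
Hypothesis Sref_pd : pdmx Sref.
Hypothesis Srho_pd : forall k, (k < T)%N -> pdmx (Srho k).
Hypothesis hA : assumptionA A (Brho B Srho) T Sini Sfin.
Hypothesis rankB : forall k, (k < T)%N -> \rank (B k) = m.

Local Notation Q := (Qrho T A B Sini Sfin Srho).
Local Notation Spi := (Spi T A B Sini Sfin Srho).
Local Notation Kpi := (Kpi T A B Sini Sfin Srho).
Local Notation Sig := (Sig T A B Sini Sfin Srho).
Local Notation P := (process_law A B (gaussian 0 Sini) (opt_policy T A B Sini Sfin Srho)).
Local Notation Qref := (process_law A B (gaussian mu_ref Sref) (prior_policy n Srho)).

Let measurable_next N : measurable_fun setT (fun p : N.+1.-tuple 'cV[R]_n * 'cV[R]_m =>
  next_state (A N) (B N) p).
Proof. exact: measurable_funPT. Qed.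

Lemma opt_process_marginal k (f : 'cV[R]_n -> \bar R) : (k <= T)%N ->
  measurable_fun setT f -> (forall x, 0 <= f x) ->
  \int[P k]_x f (state ord_max x) = \int[gaussian 0 (Sig k)]_x f x.
Proof.
elim: k f => [|k IHk] f kT mf f0.
  rewrite Sig0//.
  rewrite ge0_integral_process0//.
  exact: (measurableT_comp mf (@measurable_tnth _ _ _ _)).
have Spd := Sig_pd Sini_pd Sfin_pd Srho_pd hA (ltnW kT).
have Upd := Spi_pd Sini_pd Sfin_pd Srho_pd hA kT.
have Fu := closed_loop_pi_unit Sini_pd Sfin_pd Srho_pd hA kT.
rewrite ge0_integral_processS//; last first.
  exact: (measurableT_comp mf (@measurable_tnth _ _ _ _)).
pose g x := \int[gaussian_policy (Kpi k) (Spi k) x]_u f (A k *m x + B k *m u)%R.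
have mg : measurable_fun setT g.
  apply: (measurable_fun_integral_finite_kernel
    (fun p => f (A k *m p.1 + B k *m p.2)%R) (gaussian_policy (Kpi k) (Spi k))) => //.
  apply: (measurableT_comp mf); apply: measurable_fun_addmx.
    by apply: measurable_fun_mulmx; exact: measurable_fst.
  by apply: measurable_fun_mulmx; exact: measurable_snd.
have g0 x : 0 <= g x by apply: integral_ge0.
transitivity (\int[P k]_x g (state ord_max x)).
  apply: eq_integral => x _; apply: eq_integral => u _.
  by rewrite state_next_max.
rewrite [LHS](IHk g (ltnW kT) mg g0) -(Sig_step Sini_pd Sfin_pd Srho_pd hA kT).
exact: gaussian_affine.
Qed.

(** The logarithm of the density of the optimal law with respect to the reference law, up to a
    constant and already telescoped. The first difference compares the two initial Gaussians. *)
Definition log_ratio N (x : N.+1.-tuple 'cV[R]_n) : R :=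
  (quad (invmx Sref) mu_ref (state ord0 x) - quad (invmx Sini) 0 (state ord0 x)
  + (quad (invmx (Q 0)) 0 (state ord0 x) - quad (invmx (Q N)) 0 (state ord_max x)
  - potential A B x))%R.

Lemma measurable_log_ratio N : measurable_fun setT (@log_ratio N).
Proof.
have ms (k : 'I_N.+1) := @measurable_state R n _ k.
apply: measurable_funD; first by apply: measurable_funB; exact: measurable_quad.
apply: measurable_funB; last exact: measurable_potential.
by apply: measurable_funB; exact: measurable_quad.
Qed.

Lemma log_ratio_next k (x : k.+1.-tuple 'cV[R]_n) u : (k < T)%N ->
  log_ratio (next_state (A k) (B k) (x, u)) = (log_ratio x +
  (quad (invmx (Srho k)) 0 u
   - quad (invmx (Spi k)) (Kpi k *m state ord_max x) u))%R.
Proof.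
move=> kT; rewrite (quad_stage Sini_pd Sfin_pd Srho_pd hA)//.
rewrite /log_ratio !state0_next state_next_max potential_next ?rankB//.
ring.
Qed.

(** Each stage multiplies the density by a ratio of Gaussian densities whose normalising factor is
    independent of the current state, so the factors accumulate in the single constant [c]. *)
Lemma opt_process_density k : (k <= T)%N ->
  exists2 c : R, (0 < c)%R & forall f, measurable_fun setT f -> (forall x, 0 <= f x) ->
    \int[P k]_x f x = \int[Qref k]_x (f x * (c * expR (log_ratio x))%:E).
Proof.
elim: k => [|k IHk] kT.
  have [c c0 hc] := gaussian_density Sini_pd Sref_pd.
  exists c => // f mf f0; rewrite !ge0_integral_process0//; last 2 first.
  - apply: emeasurable_funM => //; apply/measurable_EFinP/measurable_funM => //.
    by apply: measurableT_comp => //; exact: measurable_log_ratio.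
  - by move=> x; rewrite mule_ge0// lee_fin mulr_ge0 ?expR_ge0// ltW.
  have mft : measurable_fun setT (fun x => f (traj1 x)).
    exact: (measurableT_comp mf (@measurable_funPT _ _ _ _ (@traj1 R n))).
  rewrite [LHS](hc 0%R mu_ref _ mft (fun=> f0 _)).
  apply: eq_integral => x _; rewrite /log_ratio potential0 subr0.
  rewrite (_ : ord_max = ord0 :> 'I_1) ?subrr ?addr0//; exact: val_inj.
have [c c0 hc] := IHk (ltnW kT).
have Upd := Spi_pd Sini_pd Sfin_pd Srho_pd hA kT.
have [c' c'0 hc'] := gaussian_density Upd (Srho_pd kT).
exists (c * c')%R; first exact: mulr_gt0.
move=> f mf f0.
pose g x := \int[gaussian_policy (Kpi k) (Spi k) (state ord_max x)]_u
  f (next_state (A k) (B k) (x, u)).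
have mfn : measurable_fun setT (fun p : k.+1.-tuple 'cV[R]_n * 'cV[R]_m =>
    f (next_state (A k) (B k) p)).
  exact: (measurableT_comp mf (@measurable_next k)).
have mg : measurable_fun setT g.
  exact: (measurable_integral_kpre (@state R n k.+1 ord_max)
    (gaussian_policy (Kpi k) (Spi k)) mfn).
have g0 x : 0 <= g x by apply: integral_ge0.
have mh N (a : R) : measurable_fun setT
    (fun x : N.+1.-tuple 'cV[R]_n => (a * expR (log_ratio x))%:E).
  apply/measurable_EFinP/measurable_funM => //.
  by apply: measurableT_comp => //; exact: measurable_log_ratio.
rewrite !ge0_integral_processS//; last 2 first.
- exact: emeasurable_funM mf (mh _ _).
- by move=> x; rewrite mule_ge0// lee_fin !mulr_ge0 ?expR_ge0// ltW.
rewrite -/(g _) [LHS](hc g mg g0); apply: eq_integral => x _.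
have mfx : measurable_fun setT (fun u => f (next_state (A k) (B k) (x, u))).
  exact: (measurableT_comp mfn (measurable_pair1 x)).
rewrite /g [X in X * _](hc' (Kpi k *m state ord_max x) 0%R _ mfx (fun=> f0 _)).
rewrite -ge0_integralZr//; last 3 first.
- apply: emeasurable_funM => //; apply/measurable_EFinP/measurable_funM => //.
  by apply: measurableT_comp => //; apply: measurable_funB; exact: measurable_quad.
- by move=> u _; rewrite mule_ge0// lee_fin !mulr_ge0 ?expR_ge0// ltW.
- by rewrite lee_fin !mulr_ge0 ?expR_ge0// ltW.
apply: eq_integral => u _; rewrite log_ratio_next// -muleA -EFinM; congr (_ * _%:E).
by rewrite (expRD (log_ratio x)); ring.
Qed.

End optimal_process.

(** * Relative entropy with respect to the reference process *)

Section KL_density.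
Local Open Scope ereal_scope.
Local Open Scope charge_scope.
Context d (X : measurableType d) {R : realType}.
Implicit Types P Q : probability X R.

(** Provides a version of the density that is real and nonnegative everywhere. It is positive
    [P]-almost everywhere, so the default value of [ln] at 0 does not affect the integral. *)
Lemma KL_density P Q : P `<< Q -> exists r : X -> R,
  [/\ measurable_fun setT r, forall x, (0 <= r x)%R,
      forall f, measurable_fun setT f -> (forall x, 0 <= f x) ->
        \int[P]_x f x = \int[Q]_x (f x * (r x)%:E) &
      KL P Q = \int[P]_x (ln (r x))%:E].
Proof.
move=> PQ; pose g := Radon_Nikodym_SigmaFinite.f P Q.
have gfin x : g x \is a fin_num by exact: Radon_Nikodym_SigmaFinite.f_fin_num.
have g0 x : 0 <= g x by exact: Radon_Nikodym_SigmaFinite.f_ge0.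
have mg : measurable_fun setT g.
  exact: measurable_int (Radon_Nikodym_SigmaFinite.f_integrable PQ).
exists (fun x => fine (g x)).
have mr : measurable_fun setT (fun x => fine (g x)) by exact: measurableT_comp.
have r0 x : (0 <= fine (g x))%R by exact: fine_ge0.
have rE f : measurable_fun setT f -> (forall x, 0 <= f x) ->
    \int[P]_x f x = \int[Q]_x (f x * (fine (g x))%:E).
  move=> mf f0; rewrite -(Radon_Nikodym_SigmaFinite.change_of_variables PQ)//.
  by apply: eq_integral => x _; rewrite fineK.
split => //.
rewrite /KL asboolT//.
have mlnr : measurable_fun setT (fun x => (ln (fine (g x)))%:E).
  by apply/measurable_EFinP; apply: measurableT_comp => //; exact: measurable_ln.
(* The set where the density vanishes has [P]-measure equal to the [Q]-integral of 0 over it. *)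
have r_ae : \forall x \ae P, fine (g x) != 0%R.
  exists [set x | fine (g x) = 0%R]; split.
  - rewrite -[X in measurable X]setTI; exact: (mr measurableT [set 0%R]).
  - have mZ : measurable [set x | fine (g x) = 0%R].
      by rewrite -[X in measurable X]setTI; exact: (mr measurableT [set 0%R]).
    rewrite (Radon_Nikodym_SigmaFinite.f_integral PQ mZ); apply: integral0_eq.
    by move=> x /= gx0; rewrite -[LHS](fineK (gfin x)) gx0.
  - by move=> x /= /negP/negPn/eqP.
have dE : ae_eq P setT ('d (charge_of_finite_measure P) '/d Q) g.
  apply: (null_dominates_ae_eq measurableT PQ).
  by apply: ae_eq_sym; exact: ae_eq_Radon_Nikodym_SigmaFinite.
pose D := 'd (charge_of_finite_measure P) '/d Q.
have Dfin x : D x \is a fin_num.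
  exact: (@Radon_Nikodym_fin_num _ _ _ (charge_of_finite_measure P) Q x PQ).
have mD : measurable_fun setT (fun x => fine (D x)).
  by apply: measurableT_comp => //; apply: measurable_int; exact: Radon_Nikodym_integrable.
apply: ae_eq_integral => //.
  rewrite (_ : (fun _ => _) = fun x => if (fine (D x) <= 0)%R then -oo else (ln (fine (D x)))%:E).
    apply: measurable_fun_ifT => //; first exact: measurable_fun_ler.
    by apply/measurable_EFinP; apply: measurableT_comp => //; exact: measurable_ln.
  by apply/funext => x; rewrite -/D -{1}(fineK (Dfin x)).
apply: filterS2 r_ae dE => x rx /(_ I) -> _ .
rewrite -{1}(fineK (gfin x)) lne_EFin// lt0r rx; exact: r0.
Qed.

End KL_density.

Section real_log.
Context {R : realType}.

Lemma negpart_le_expRN (x : R) : Num.max (- x) 0 <= expR (- x).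
Proof. by rewrite ge_max expR_ge0 andbT; have := expR_ge1Dx (- x); lra. Qed.

Lemma expRN_ln_le1 (r : R) : 0 <= r -> expR (- ln r) * r <= 1.
Proof.
move=> r0; have [->|rn0] := eqVneq r 0; first by rewrite mulr0.
have rp : 0 < r by rewrite lt0r rn0.
by rewrite expRN lnK ?posrE// mulVf.
Qed.

(** Used with [x] the logarithm of a density [dP/dP']: as [exp (- x)] has [P]-integral at most one,
    integration yields nonnegativity of the relative entropy, and strictness away from 0 settles the
    equality case. *)
Lemma expR_gap_ge0 (x : R) : 0 <= x - 1 + expR (- x).
Proof. by have := expR_ge1Dx (- x); lra. Qed.

Lemma expR_gap_eq0 (x : R) : x - 1 + expR (- x) = 0 -> x = 0.
Proof.
move=> h; apply/eqP/negPn/negP => x0; have := @expR_gt1Dx R (- x).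
by rewrite oppr_eq0 => /(_ x0); lra.
Qed.

End real_log.

Section integrability.
Local Open Scope ereal_scope.
Context d (X : measurableType d) {R : realType} (P : probability X R).

Lemma integral_prob_cst1 : \int[P]_x (cst 1 x) = 1.
Proof. by rewrite integral_cst// mul1e; exact: probability_setT. Qed.

Lemma integrable_of_lty (f : X -> R) : measurable_fun setT f ->
  \int[P]_x (EFin \o f)^\- x < +oo -> \int[P]_x (f x)%:E < +oo ->
  P.-integrable setT (EFin \o f).
Proof.
move=> mf fn; rewrite integralE => flt.
have mEf : measurable_fun setT (EFin \o f) by exact/measurable_EFinP.
have fnfin : \int[P]_x (EFin \o f)^\- x \is a fin_num.
  by rewrite ge0_fin_numE//; apply: integral_ge0.
apply/integrableP; split=> //.
rewrite -[fun x => `| _ |]/(abse \o (EFin \o f)) fune_abse ge0_integralD//; last 2 first.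
- exact: measurable_funepos.
- exact: measurable_funeneg.
rewrite lte_add_pinfty//.
by move: flt; rewrite lteBlDr// -(fineK fnfin) addye.
Qed.

Lemma ge0_integrable_lty (f : X -> R) : measurable_fun setT f -> (forall x, (0 <= f x)%R) ->
  \int[P]_x (f x)%:E < +oo -> P.-integrable setT (EFin \o f).
Proof.
move=> mf f0 flt; apply/integrableP; split; first exact/measurable_EFinP.
by under eq_integral do rewrite /= ger0_norm//.
Qed.

End integrability.

Section variational.
Local Open Scope ereal_scope.
Context d (X : measurableType d) {R : realType}.
Variables (Q Pstar : probability X R) (V psi : X -> R).
Hypotheses (mV : measurable_fun setT V) (mpsi : measurable_fun setT psi).
Hypothesis V0 : forall x, (0 <= V x)%R.
Hypothesis PstarE : forall f, measurable_fun setT f -> (forall x, 0 <= f x) ->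
  \int[Pstar]_x f x = \int[Q]_x (f x * (expR (psi x - V x))%:E).

Let mh : measurable_fun setT (fun x => (expR (psi x - V x))%:E).
Proof.
by apply/measurable_EFinP; apply: measurableT_comp => //; exact: measurable_funB.
Qed.

Let h0 x : 0 <= (expR (psi x - V x))%:E.
Proof. by rewrite lee_fin expR_ge0. Qed.

Lemma Pstar_dominated : Pstar `<< Q.
Proof.
apply/null_content_dominatesP => A mA QA0.
rewrite -(setIT A) -integral_indic// PstarE//; last first.
  exact/measurable_EFinP.
rewrite -(null_set_integral mA (measurable_funTS mh) QA0) [RHS]integral_mkcond.
by apply: eq_integral => x _; rewrite epatch_indic /= muleC.
Qed.

Section fixed_competitor.
Variables (P : probability X R) (r : X -> R).
Hypotheses (mr : measurable_fun setT r) (r0 : forall x, (0 <= r x)%R).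
Hypothesis PE : forall f, measurable_fun setT f -> (forall x, 0 <= f x) ->
  \int[P]_x f x = \int[Q]_x (f x * (r x)%:E).

Let mlnr : measurable_fun setT (fun x => ln (r x)).
Proof. by apply: measurableT_comp => //; exact: measurable_ln. Qed.

(** The negative part of [ln r] is at most [exp (- ln r)], and [exp (- ln r) * r <= 1] bounds the
    [P]-integral of the latter by the total mass of [Q]. *)
Lemma ln_density_neg : \int[P]_x (EFin \o (fun x => ln (r x)))^\- x < +oo.
Proof.
apply: (@le_lt_trans _ _ 1); last exact: ltry.
have me : measurable_fun setT (fun x => (expR (- ln (r x)))%:E).
  apply/measurable_EFinP; apply: measurableT_comp => //; exact: measurableT_comp.
have e0 x : 0 <= (expR (- ln (r x)))%:E by rewrite lee_fin expR_ge0.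
apply: (@le_trans _ _ (\int[P]_x (expR (- ln (r x)))%:E)).
  apply: ge0_le_integral => //.
  - by apply: measurable_funeneg; exact/measurable_EFinP.
  - move=> x _; rewrite funenegE /= -EFin_max lee_fin.
    exact: negpart_le_expRN.
rewrite PE//; apply: (@le_trans _ _ (\int[Q]_x (cst 1 x))).
  apply: ge0_le_integral => //.
  - by move=> x _; rewrite mule_ge0// lee_fin.
  - by apply: emeasurable_funM => //; exact/measurable_EFinP.
  - by move=> x _; rewrite -EFinM lee_fin expRN_ln_le1.
by rewrite integral_prob_cst1.
Qed.

Hypothesis lnr_int : P.-integrable setT (EFin \o (fun x => ln (r x))).
Hypothesis V_int : P.-integrable setT (EFin \o V).
Hypothesis psi_int : P.-integrable setT (EFin \o psi).

(* [D] is the logarithm of the density of [P] with respect to [Pstar], wherever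
   [r] is positive. *)
Let D x : R := (ln (r x) + V x - psi x)%R.
Let E x : R := expR (- D x).

Let mD : measurable_fun setT D.
Proof. by apply: measurable_funB => //; exact: measurable_funD. Qed.

Let mE : measurable_fun setT E.
Proof. by apply: measurableT_comp => //; exact: measurableT_comp. Qed.

Let E0 x : (0 <= E x)%R. Proof. exact: expR_ge0. Qed.

Let DE : EFin \o D =
  ((EFin \o (fun x => ln (r x))) \+ (EFin \o V)) \- (EFin \o psi).
Proof. by apply/funext => x /=; rewrite EFinB EFinD. Qed.

Let D_int : P.-integrable setT (EFin \o D).
Proof. by rewrite DE; apply: integrableB => //; exact: integrableD. Qed.

Let Er_le x : (E x * r x <= expR (psi x - V x))%R.
Proof.
have [->|rn0] := eqVneq (r x) 0%R; first by rewrite mulr0 expR_ge0.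
have rp : (0 < r x)%R by rewrite lt0r rn0 r0.
rewrite -[X in (_ * X)%R](lnK (x := r x)) ?posrE// /E -expRD ler_expR /D; lra.
Qed.

(** [E] is the density of [Pstar] with respect to [P] only where [r > 0]; the mass that [Pstar] may
    put on [r = 0] is lost, hence an inequality. *)
Let E_le U : measurable U -> \int[P]_x (\1_U x * E x)%:E <= Pstar U.
Proof.
move=> mU; rewrite -[X in _ <= _ X]setIT -integral_indic//.
have mUE : measurable_fun setT (fun x => (\1_U x * E x)%:E).
  by apply/measurable_EFinP; apply: measurable_funM.
have UE0 x : 0 <= (\1_U x * E x)%:E by rewrite lee_fin mulr_ge0.
have mU1 : measurable_fun setT (fun x => (\1_U x : R)%:E) by exact/measurable_EFinP.
rewrite PE// PstarE//.
apply: ge0_le_integral => //.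
- by move=> x _; rewrite mule_ge0// lee_fin.
- by apply: emeasurable_funM => //; exact/measurable_EFinP.
- exact: emeasurable_funM.
- by move=> x _; rewrite -!EFinM lee_fin -mulrA ler_wpM2l.
Qed.

Let intE_le1 : \int[P]_x (E x)%:E <= 1.
Proof.
have := E_le measurableT; rewrite probability_setT; apply: le_trans.
by under [leRHS]eq_integral do rewrite indicT mul1r.
Qed.

Let E_int : P.-integrable setT (EFin \o E).
Proof. by apply: ge0_integrable_lty => //; rewrite (le_lt_trans intE_le1)// ltry. Qed.

Let gap x : R := (D x - 1 + E x)%R.

Let cst1_int : P.-integrable setT (EFin \o cst 1%R).
Proof.
by apply: ge0_integrable_lty => //; rewrite integral_prob_cst1 ltry.
Qed.

Let gapE : EFin \o gap = ((EFin \o D) \- (EFin \o cst 1%R)) \+ (EFin \o E).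
Proof. by apply/funext => x /=; rewrite EFinD EFinB. Qed.

Let gap_int : P.-integrable setT (EFin \o gap).
Proof. by rewrite gapE; apply: integrableD => //; exact: integrableB. Qed.

Let integral_gap : \int[P]_x (gap x)%:E <= \int[P]_x (D x)%:E.
Proof.
rewrite -[leLHS]/(\int[P]_x (EFin \o gap) x) gapE integralD//; last exact: integrableB.
rewrite integralB// integral_prob_cst1.
have := intE_le1; have := integrable_fin_num measurableT E_int.
have := integrable_fin_num measurableT D_int.
rewrite -!/(_ \o _).
move=> /fineK <- /fineK <-; rewrite -EFinB -EFinD !lee_fin; lra.
Qed.

Let gap_ge0 x : (0 <= gap x)%R. Proof. exact: expR_gap_ge0. Qed.

Let integral_D : \int[P]_x (D x)%:E =
  \int[P]_x (ln (r x))%:E + \int[P]_x (V x)%:E - \int[P]_x (psi x)%:E.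
Proof.
rewrite -[LHS]/(\int[P]_x (EFin \o D) x) DE integralB//; last exact: integrableD.
by rewrite integralD.
Qed.

Lemma competitor_ge :
  \int[P]_x (psi x)%:E <= \int[P]_x (ln (r x))%:E + \int[P]_x (V x)%:E.
Proof.
have : 0 <= \int[P]_x (D x)%:E.
  by apply: le_trans integral_gap; apply: integral_ge0 => x _; rewrite lee_fin.
have := integrable_fin_num measurableT psi_int => /= psi_fin.
by rewrite integral_D sube_ge0 ?psi_fin ?orbT.
Qed.

(** Equality of the costs forces the nonnegative gap to vanish [P]-almost everywhere, so [E = 1]
    there and [P U <= Pstar U] for all [U]. Both masses being one, the same inequality for
    complements gives equality. *)
Lemma competitor_eq :
  \int[P]_x (ln (r x))%:E + \int[P]_x (V x)%:E <= \int[P]_x (psi x)%:E ->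
  same_law P Pstar.
Proof.
move=> le_cost.
have gap0 : ae_eq P setT (fun x => (gap x)%:E) (cst 0).
  apply: (proj1 (ae_eq_integral_abs P measurableT (measurable_int P gap_int))).
  apply/eqP; rewrite eq_le integral_ge0// andbT.
  under eq_integral do rewrite gee0_abs ?lee_fin//.
  apply: (le_trans integral_gap); rewrite integral_D.
  have := integrable_fin_num measurableT psi_int => /= psi_fin.
  by rewrite leeBlDr// add0e.
have le_law U : measurable U -> P U <= Pstar U.
  move=> mU; apply: le_trans (E_le mU).
  rewrite -[X in P X]setIT -integral_indic//.
  rewrite le_eqVlt; apply/orP; left; apply/eqP; apply: ge0_ae_eq_integral => //.
  - exact/measurable_EFinP.
  - by apply/measurable_EFinP; apply: measurable_funM.
  - by move=> x _; rewrite lee_fin mulr_ge0 ?E0.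
  - apply: filterS gap0 => x /(_ I) [] /expR_gap_eq0 Dx0 _.
    by rewrite /E Dx0 oppr0 expR0 mulr1.
move=> U mU; apply/eqP; rewrite eq_le le_law//=.
have := le_law _ (measurableC mU); rewrite !probability_setC//.
have := fin_num_measure P U mU; have := fin_num_measure Pstar U mU.
by move=> /fineK <- /fineK <-; rewrite -!EFinB !lee_fin; lra.
Qed.

End fixed_competitor.
End variational.

Section minimizer.
Local Open Scope ereal_scope.
Context d (X : measurableType d) {R : realType}.
Variables (Q Pstar : probability X R) (V psi : X -> R).
Hypotheses (mV : measurable_fun setT V) (mpsi : measurable_fun setT psi).
Hypothesis V0 : forall x, (0 <= V x)%R.
Hypothesis PstarE : forall f, measurable_fun setT f -> (forall x, 0 <= f x) ->
  \int[Pstar]_x f x = \int[Q]_x (f x * (expR (psi x - V x))%:E).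
Variables (C : probability X R -> Prop) (kappa : R).
Hypothesis CPstar : C Pstar.
Hypothesis Cpsi : forall P, C P ->
  P.-integrable setT (EFin \o psi) /\ \int[P]_x (psi x)%:E = kappa%:E.

Let J (P : probability X R) : \bar R := KL P Q + \int[P]_x (V x)%:E.

Let intV_ge0 (P : probability X R) : 0 <= \int[P]_x (V x)%:E.
Proof. by apply: integral_ge0 => x _; rewrite lee_fin. Qed.

(** Neither term of the cost can be [-oo]: [V] is nonnegative and the negative part of [ln r] is
    integrable. A finite sum therefore makes each term finite. *)
Lemma cost_dichotomy (P : probability X R) : J P < +oo ->
  exists r : X -> R, [/\ measurable_fun setT r, forall x, (0 <= r x)%R,
    forall f, measurable_fun setT f -> (forall x, 0 <= f x) ->
        \int[P]_x f x = \int[Q]_x (f x * (r x)%:E),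
    P.-integrable setT (EFin \o (fun x => ln (r x))) /\ P.-integrable setT (EFin \o V) &
    J P = \int[P]_x (ln (r x))%:E + \int[P]_x (V x)%:E].
Proof.
have VNy : \int[P]_x (V x)%:E != -oo by rewrite gt_eqF// (lt_le_trans _ (intV_ge0 P))// ltNy0.
have [PQ|nPQ] := pselect (P `<< Q); last first.
  by rewrite /J /KL asboolF// addye.
have [r [mr r0 rE KLE]] := KL_density PQ; rewrite /J KLE => Jlty.
have mlnr : measurable_fun setT (fun x => ln (r x)).
  by apply: measurableT_comp => //; exact: measurable_ln.
have neg := ln_density_neg mr r0 rE.
have lnNy : \int[P]_x (ln (r x))%:E != -oo.
  have neg_fin : \int[P]_x (EFin \o (fun x => ln (r x)))^\- x \is a fin_num.
    by rewrite ge0_fin_numE//; apply: integral_ge0.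
  rewrite integralE -(fineK neg_fin) gt_eqF//.
  apply: (@lt_le_trans _ _ (0 - (fine (\int[P]_x (EFin \o (fun x => ln (r x)))^\- x))%:E)).
    by rewrite sub0e ltNyr.
  by rewrite leeD2r//; apply: integral_ge0.
exists r; split=> //; split.
  apply: (integrable_of_lty mlnr neg).
  move: Jlty; case: (X in X + _) lnNy => [a||]// _.
    by rewrite ltry.
  by rewrite addye.
apply: ge0_integrable_lty => //.
by move: Jlty; case: (X in _ + X) VNy => [a||]// _; rewrite ?ltry// addey.
Qed.

Lemma cost_ge P : C P -> kappa%:E <= J P.
Proof.
move=> CP; have [Plty|] := ltP (J P) +oo; last by rewrite leye_eq => /eqP ->; rewrite leey.
have [r [mr r0 rE [lnr_int V_int] ->]] := cost_dichotomy Plty.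
have [psi_int <-] := Cpsi CP.
exact: (competitor_ge mV mpsi PstarE mr r0 rE).
Qed.

(** Almost everywhere [ln r = psi - V], but cancelling [V] requires its integrability, which is not
    given: it follows from [V = psi - ln r <= |psi| + (ln r)^-]. *)
Lemma cost_Pstar : J Pstar = kappa%:E.
Proof.
have [psi_int <-] := Cpsi CPstar.
have PQ := Pstar_dominated mV mpsi PstarE.
have [r [mr r0 rE KLE]] := KL_density PQ.
have mlnr : measurable_fun setT (fun x => ln (r x)).
  by apply: measurableT_comp => //; exact: measurable_ln.
pose h x : R := expR (psi x - V x).
have mh : measurable_fun setT h by apply: measurableT_comp => //; exact: measurable_funB.
have set_density (g : X -> R) U : measurable U -> measurable_fun setT g ->
    (forall f, measurable_fun setT f -> (forall x, 0 <= f x) ->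
      \int[Pstar]_x f x = \int[Q]_x (f x * (g x)%:E)) ->
    \int[Q]_(x in U) (g x)%:E = Pstar U.
  move=> mU mg gE; rewrite -[X in Pstar X]setIT -integral_indic// gE//; last first.
    exact/measurable_EFinP.
  rewrite integral_mkcond; apply: eq_integral => x _.
  by rewrite epatch_indic /= muleC.
have rh : ae_eq Pstar setT (EFin \o r) (EFin \o h).
  apply: (null_dominates_ae_eq measurableT PQ); apply: integral_ae_eq => //.
  - apply: ge0_integrable_lty => //.
    by rewrite set_density// probability_setT ltry.
  - exact/measurable_EFinP.
  - by move=> U _ mU; rewrite !set_density.
have lnrE : ae_eq Pstar setT (fun x => (ln (r x))%:E) (fun x => (psi x - V x)%:E).
  by apply: filterS rh => x /(_ I) [->] _; rewrite /h expRK.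
have V_int : Pstar.-integrable setT (EFin \o V).
  apply: ge0_integrable_lty => //.
  have mneg : measurable_fun setT (EFin \o (fun x => ln (r x)))^\-.
    by apply: measurable_funeneg; exact/measurable_EFinP.
  have mabs : measurable_fun setT (fun x => `|(psi x)%:E|).
    by apply: measurableT_comp => //; exact/measurable_EFinP.
  apply: (@le_lt_trans _ _ (\int[Pstar]_x
      (`|(psi x)%:E| + (EFin \o (fun x => ln (r x)))^\- x))); last first.
    rewrite ge0_integralD//; apply: lte_add_pinfty.
      by case/integrableP : psi_int.
    exact: ln_density_neg mr r0 rE.
  (* [V = psi - ln r] holds only almost everywhere. Truncation at 0 changes nothing there, since
     [V >= 0], and gives an integrand for which the bound holds everywhere. *)
  rewrite (_ : \int[Pstar]_x (V x)%:E = \int[Pstar]_x (maxe (psi x - ln (r x))%:E 0)).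
    apply: ge0_le_integral => //.
    - by move=> x _; rewrite le_max lexx orbT.
    - by apply: measurable_maxe => //; apply/measurable_EFinP; exact: measurable_funB.
    - exact: emeasurable_funD.
    - move=> x _; rewrite funenegE /= -!EFin_max -EFinD lee_fin ge_max.
      have := ler_norm (psi x); have := normr_ge0 (psi x).
      by case: (leP (- ln (r x))%R 0%R); lra.
  apply: ge0_ae_eq_integral => //.
  - exact/measurable_EFinP.
  - by apply: measurable_maxe => //; apply/measurable_EFinP; exact: measurable_funB.
  - by move=> x _; rewrite lee_fin.
  - by move=> x _; rewrite le_max lexx orbT.
  - apply: filterS lnrE => x /(_ I) [->] _; rewrite -EFin_max; congr EFin.
    by rewrite subKr max_l.
rewrite /J KLE (_ : \int[Pstar]_x (ln (r x))%:E = \int[Pstar]_x (psi x - V x)%:E); last first.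
  apply: ae_eq_integral => //; first exact/measurable_EFinP.
  by apply/measurable_EFinP; exact: measurable_funB.
under [X in X + _]eq_integral do rewrite EFinB.
rewrite (integralB measurableT psi_int V_int).
have := integrable_fin_num measurableT V_int => /= V_fin.
by rewrite subeK.
Qed.

Lemma unique_minimizer_density : unique_minimizer C J Pstar.
Proof.
split; first by split=> // P CP; rewrite cost_Pstar; exact: cost_ge.
move=> P [CP minP]; have := minP _ CPstar; rewrite cost_Pstar => JP.
have [r [mr r0 rE [lnr_int V_int] JE]] := cost_dichotomy (le_lt_trans JP (ltry _)).
have [psi_int psiE] := Cpsi CP.
apply: (competitor_eq mV mpsi PstarE mr r0 rE) => //.
by rewrite -JE psiE.
Qed.

End minimizer.

(** * Quadratic moments and end marginals *)

Section gaussian_moments.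
Context {R : realType}.

Lemma dotc_mulmx_bound n (M : 'M[R]_n) :
  exists2 K : R, 0 <= K & forall y, `|dotc y (M *m y)| <= K * dotc y y.
Proof.
exists (\sum_i \sum_j `|M i j|); first by apply: sumr_ge0 => i _; apply: sumr_ge0.
move=> y.
have sq i : y i ord0 ^+ 2 <= dotc y y.
  rewrite dotcE (bigD1 i)//= -expr2 lerDl.
  by apply: sumr_ge0 => j _; rewrite -expr2 sqr_ge0.
rewrite [in leLHS]dotcE mulr_suml; apply: (le_trans (ler_norm_sum _ _ _)).
apply: ler_sum => i _; rewrite mxE mulr_sumr mulr_suml.
apply: (le_trans (ler_norm_sum _ _ _)); apply: ler_sum => j _.
rewrite mulrCA normrM ler_wpM2l// normrM.
have := sq i; have := sq j.
rewrite -(real_normK (num_real (y i ord0))) -(real_normK (num_real (y j ord0))).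
have := sqr_ge0 (`|y i ord0| - `|y j ord0|).
move: `|y i ord0| `|y j ord0| (dotc y y) => a b c; clear; nra.
Qed.

Local Open Scope ereal_scope.

(** [|z|^2 <= 4 exp (|z|^2 / 4)], and the Gaussian integral of [exp (|z|^2 / 4)] is [lebint] of
    [exp (- |z|^2 / 4)], the standard Gaussian function after scaling by [(1/2)^(1/2)]. *)
Lemma std_gaussian_sq_lty n : \int[@std_gaussian R n]_z (dotc z z)%:E < +oo.
Proof.
have su : ((Num.sqrt (1 / 2))%:M : 'M[R]_n) \in unitmx.
  apply: pdmx_unit; apply: pdmx_scalar; rewrite sqrtr_gt0; lra.
have [c c0 hc] := lebint_mulmx su.
have mg a : measurable_fun setT (fun z : 'cV[R]_n => (expR (a * dotc z z))%:E).
  apply/measurable_EFinP; apply: measurableT_comp => //; apply: measurable_funM => //.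
  exact: measurable_fun_dotc.
have md : measurable_fun setT (fun z : 'cV[R]_n => (dotc z z)%:E).
  by apply/measurable_EFinP; exact: measurable_fun_dotc.
apply: (@le_lt_trans _ _ (\int[@std_gaussian R n]_z (4%:E * (expR (4^-1 * dotc z z))%:E))).
  apply: ge0_le_integral => //.
  - by move=> z _; rewrite lee_fin dotcxx_ge0.
  - exact: measurable_funeM.
  - move=> z _; rewrite -EFinM lee_fin.
    by have := expR_ge1Dx (4^-1 * dotc z z)%R; lra.
rewrite ge0_integralZl//.
suff -> : \int[@std_gaussian R n]_z (expR (4^-1 * dotc z z))%:E = c%:E.
  by rewrite -EFinM ltry.
rewrite -[RHS]mule1 -(@lebint_gauss R n) -hc; last 2 first.
- rewrite (_ : (fun _ => _) = fun z : 'cV[R]_n => (expR (- 2^-1 * dotc z z))%:E); first exact: mg.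
  by apply/funext => z; congr (expR _)%:E; field.
- by move=> z; rewrite lee_fin expR_ge0.
apply: eq_integral => z _; rewrite -EFinM -expRD; congr (expR _)%:E.
rewrite mul_scalar_mx dotcZl dotcZr mulrA -expr2 sqr_sqrtr; last by lra.
by field.
Qed.

Lemma integrable_quad_gaussian n (mu a : 'cV[R]_n) (S M : 'M[R]_n) :
  (gaussian mu S).-integrable setT (EFin \o quad M a).
Proof.
have mq : measurable_fun setT (quad M a) by exact: measurable_quad.
apply/integrableP; split; first exact/measurable_EFinP.
have mabs : measurable_fun setT (fun y => `|(EFin \o quad M a) y|).
  by apply: measurableT_comp => //; exact/measurable_EFinP.
rewrite ge0_integral_distribution//.
pose N := sqrtmx S; pose b := (mu - a)%R.
have [K K0 hK] := dotc_mulmx_bound M.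
have [L L0 hL] := dotc_mulmx_bound (N^T *m N).
have md : measurable_fun setT (fun z : 'cV[R]_n => (dotc z z)%:E).
  by apply/measurable_EFinP; exact: measurable_fun_dotc.
(* For [y = b + N z], [|y|^2 <= 2 |b|^2 + 2 |N z|^2]; the factor 2 cancels the one half in
   [quad]. *)
apply: (@le_lt_trans _ _ (\int[@std_gaussian R n]_z ((K * L)%:E * (dotc z z)%:E + (cst (K * dotc b b)%:E) z))).
  apply: ge0_le_integral => //.
  - by move=> z _ /=; rewrite lee_fin.
  - exact: (measurableT_comp mabs (@measurable_funPT _ _ _ _ (gaussian_map mu S))).
  - by apply: emeasurable_funD => //; exact: measurable_funeM.
  - move=> z _ /=; rewrite -EFinM -EFinD lee_fin /quad /gaussian_map.
    rewrite addrAC -/N -/b normrM (ger0_norm (x := 2^-1)) ?invr_ge0//.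
    have := hL z; rewrite -mulmxA dotc_mulr trmxK => /(le_trans (ler_norm _)).
    move: (b) (N *m z) => b' Nz h2; set y := (b' + Nz)%R.
    have h1 := hK y.
    have h3 : (dotc y y <= 2 * dotc b' b' + 2 * dotc Nz Nz)%R.
      have := dotcxx_ge0 (b' - Nz).
      rewrite /y !(dotcDl, dotcDr, dotcNl, dotcNr) (dotcC Nz b').
      move: (dotc b' b') (dotc b' Nz) (dotc Nz Nz) => p q r; clear; lra.
    move: h1 h2 h3 K0; move: (`|dotc y (M *m y)|%R) (dotc y y) (dotc b' b') (dotc Nz Nz) (dotc z z).
    clear; move=> p q r s t; nra.
rewrite ge0_integralD//; last 3 first.
- by move=> z _; rewrite mule_ge0// lee_fin ?mulr_ge0// dotcxx_ge0.
- exact: measurable_funeM.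
- by move=> z _; rewrite lee_fin mulr_ge0// dotcxx_ge0.
rewrite ge0_integralZl//; last 2 first.
- by move=> z _; rewrite lee_fin dotcxx_ge0.
- by rewrite lee_fin mulr_ge0.
apply: lte_add_pinfty; first by rewrite lte_mul_pinfty ?lee_fin ?mulr_ge0 ?std_gaussian_sq_lty.
rewrite integral_cst// [X in _ * X](_ : _ = 1) ?mule1 ?ltry//.
exact: probability_setT.
Qed.

End gaussian_moments.

Section same_law_integral.
Local Open Scope ereal_scope.
Context d (X : measurableType d) d' (Y : measurableType d') {R : realType}.

Lemma same_law_integral (P : probability X R) (h : {mfun X >-> Y})
    (mu : probability Y R) (f : Y -> R) :
  same_law (distribution P h) mu -> mu.-integrable setT (EFin \o f) ->
  P.-integrable setT (EFin \o (f \o h)) /\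
  \int[P]_x (f (h x))%:E = \int[mu]_y (f y)%:E.
Proof.
move=> Pmu /integrableP[mf fint].
have mfh : measurable_fun setT (EFin \o (f \o h)) by exact: measurableT_comp mf _.
have law_int g : \int[distribution P h]_y g y = \int[mu]_y g y.
  by apply: eq_measure_integral => A mA _; exact: Pmu.
have Pint : P.-integrable setT (EFin \o (f \o h)).
  apply/integrableP; split=> //.
  move: fint; rewrite -law_int ge0_integral_distribution//.
  exact: measurableT_comp.
by split=> //; rewrite -law_int integral_distribution.
Qed.

End same_law_integral.

Section optimal_process_bridge.
Local Open Scope ereal_scope.
Context {R : realType} {n m : nat}.
Variables (T : nat) (A : nat -> 'M[R]_n) (B : nat -> 'M[R]_(n, m)).
Variables (Sini Sfin : 'M[R]_n) (Srho : nat -> 'M[R]_m).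
Hypotheses (Sini_pd : pdmx Sini) (Sfin_pd : pdmx Sfin).
Hypothesis Srho_pd : forall k, (k < T)%N -> pdmx (Srho k).
Hypothesis hA : assumptionA A (Brho B Srho) T Sini Sfin.

Lemma same_law_of_integral d (X : measurableType d) (P P' : probability X R) :
  (forall f, measurable_fun setT f -> (forall x, 0 <= f x) ->
    \int[P]_x f x = \int[P']_x f x) -> same_law P P'.
Proof.
move=> h U mU; rewrite -[X in P X]setIT -[X in P' X]setIT -!integral_indic//.
by apply: h; first exact/measurable_EFinP.
Qed.

Lemma opt_process_bridge : bridge_set Sini Sfin
  (process_law A B (gaussian 0 Sini) (opt_policy T A B Sini Sfin Srho) T).
Proof.
split; apply: same_law_of_integral => f mf f0; rewrite ge0_integral_distribution//.
  exact: ge0_integral_process_initial.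
rewrite -[in RHS](SigT Sini_pd Sfin_pd hA).
exact: (opt_process_marginal Sini_pd Sfin_pd Srho_pd hA).
Qed.

End optimal_process_bridge.

Theorem theorem25 (R : realType) (n m T : nat)
    (A : nat -> 'M[R]_n) (B : nat -> 'M[R]_(n, m))
    (Sini Sfin Sref : 'M[R]_n) (mu_ref : 'cV[R]_n) (Srho : nat -> 'M[R]_m)
    (T_ge1 : (1 <= T)%N)
    (Sini_pd : pdmx Sini) (Sfin_pd : pdmx Sfin) (Sref_pd : pdmx Sref)
    (Srho_pd : forall k : nat, (k < T)%N -> pdmx (Srho k))
    (hA : assumptionA A (Brho B Srho) T Sini Sfin)
    (B_full_col_rank : forall k : nat, (k < T)%N -> \rank (B k) = m) :
  unique_minimizer
    (bridge_set Sini Sfin)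
    (bridge_cost A B
       (process_law A B (gaussian mu_ref Sref) (prior_policy n Srho) T))
    (process_law A B (gaussian 0 Sini) (opt_policy T A B Sini Sfin Srho) T).
Proof.
have [c c0 hc] := opt_process_density mu_ref Sini_pd Sfin_pd Sref_pd Srho_pd hA
  B_full_col_rank (leqnn T).
set P := process_law _ _ (gaussian 0 Sini) _ _ in hc *.
set Q := process_law _ _ (gaussian mu_ref _) _ _ in hc *.
(* Apart from the potential, the log-density is a function of [x_0] plus a function of [x_T], so the
   two prescribed marginals fix its expectation. The normalising [ln c] is placed in the initial
   part. *)
pose phi0 (x : 'cV[R]_n) := ln c + (quad (invmx Sref) mu_ref x
  - quad (invmx Sini) 0 x + quad (invmx (Qrho T A B Sini Sfin Srho 0)) 0 x).
pose phiT (x : 'cV[R]_n) := - quad (invmx (Qrho T A B Sini Sfin Srho T)) 0 x.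
have int0 : (gaussian 0 Sini).-integrable setT (EFin \o phi0).
  rewrite (_ : EFin \o phi0 = (cst (ln c)%:E \+
    (((EFin \o quad (invmx Sref) mu_ref) \- (EFin \o quad (invmx Sini) 0))
    \+ (EFin \o quad (invmx (Qrho T A B Sini Sfin Srho 0)) 0)))%E); last first.
    by apply/funext => x /=; rewrite /phi0 !EFinD EFinN.
  apply: integrableD => //; first exact: finite_measure_integrable_cst.
  apply: integrableD => //; last exact: integrable_quad_gaussian.
  by apply: integrableB => //; exact: integrable_quad_gaussian.
have intT : (gaussian 0 Sfin).-integrable setT (EFin \o phiT).
  rewrite (_ : EFin \o phiT = -%E \o
    (EFin \o quad (invmx (Qrho T A B Sini Sfin Srho T)) 0))//.
  by apply: integrableN => //; exact: integrable_quad_gaussian.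
pose psi (x : T.+1.-tuple 'cV[R]_n) := phi0 (state ord0 x) + phiT (state ord_max x).
have -> : bridge_cost A B Q = fun P' => (KL P' Q + \int[P']_x (potential A B x)%:E)%E.
  by apply/funext => P'; rewrite /bridge_cost unlock.
have mphi0 : measurable_fun setT phi0 by apply/measurable_EFinP; exact: measurable_int int0.
have mphiT : measurable_fun setT phiT by apply/measurable_EFinP; exact: measurable_int intT.
apply: (@unique_minimizer_density _ _ _ Q P (potential A B) psi _ _ _ _ _
  (fine (\int[gaussian 0 Sini]_x (phi0 x)%:E) + fine (\int[gaussian 0 Sfin]_x (phiT x)%:E))).
- exact: measurable_potential.
- apply: measurable_funD.
    exact: (measurableT_comp mphi0 (measurable_state _)).
  exact: (measurableT_comp mphiT (measurable_state _)).
- exact: potential_ge0.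
- move=> f mf f0; rewrite hc//; apply: eq_integral => x _; congr (_ * _%:E)%E.
  rewrite -{1}(lnK c0) -expRD; congr expR.
  by rewrite /psi /phi0 /phiT /log_ratio; ring.
- exact: opt_process_bridge.
- move=> P' [law0 lawT].
  have [i0 e0] := same_law_integral law0 int0.
  have [iT eT] := same_law_integral lawT intT.
  split; first by exact: (integrableD measurableT i0 iT).
  under eq_integral do rewrite EFinD.
  rewrite (integralD measurableT i0 iT) e0 eT EFinD !fineK//.
    exact: (integrable_fin_num measurableT intT).
  exact: (integrable_fin_num measurableT int0).
Qed.
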